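(* Consider the 5-parameter family of dynamical systems on the torus $\mathbb T^2=\mathbb R^2_{\theta,\tau}/2\pi\mathbb Z^2$ $$\frac{d\theta}{d\tau}=\frac{\cos\theta+B+A\sin\tau}{\omega(1-\delta\cos\tau)}+D,\qquad \omega\in\mathbb R\setminus\{0\},\ \delta\in(0,1),\ A,B,D\in\mathbb R.$$ 1) If $A\neq0$, then for arbitrary $\delta\in(0,1)$, $\omega\in\mathbb R\setminus\{0\}$, $B,D\in\mathbb R$ the Poincaré map of the system is not the identity. 2) If a system of the family with $A=0$ has identity Poincaré map, then there exists $n\in\mathbb Z$ such that $$B^2-1=\omega^2(1-\delta^2)(D-n)^2.$$
   Context: For a differential equation $\frac{d\theta}{d\tau}=f(\theta,\tau)$ on $\mathbb T^2$, with $f$ being $2\pi$-periodic in $\theta$ and $\tau$, the Poincaré (first return) map is the diffeomorphism of the transversal circle $S^1=S^1_\theta\times\{0\}$ given by the time $2\pi$ flow map: it sends an initial condition $\theta(0)$ to $\theta(2\pi)$ (mod $2\pi$). *)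

(* Defs.v *)
From Stdlib Require Import Reals Lra ClassicalEpsilon.
From Coquelicot Require Import Coquelicot.
Open Scope R_scope.

(* The circle R / 2 pi Z, each class being represented by its unique element
   in [0, 2 pi). *)
Definition circle : Type := {x : R | 0 <= x < 2 * PI}.

Lemma mod_2pi_bounds (x : R) :
  0 <= 2 * PI * frac_part (x / (2 * PI)) < 2 * PI.
Proof.
pose proof PI_RGT_0.
destruct (base_fp (x / (2 * PI))) as [H0 H1].
split; nra.
Qed.

Definition mod_2pi (x : R) : circle :=
  exist _ (2 * PI * frac_part (x / (2 * PI))) (mod_2pi_bounds x).

Definition is_solution (f : R -> R -> R) (theta : R -> R) : Prop :=
  forall tau : R, is_derive theta tau (f (theta tau) tau).

(* The solution with initial value x at time 0.  It is chosen with epsilon; for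
   the smooth right-hand sides with bounded theta-derivative considered here,
   it exists on all of R and is unique, so the default constant is not used. *)
Definition flow (f : R -> R -> R) (x : R) : R -> R :=
  epsilon (inhabits (fun _ : R => x))
    (fun theta : R -> R => is_solution f theta /\ theta 0 = x).

Definition poincare_map (f : R -> R -> R) (z : circle) : circle :=
  mod_2pi (flow f (proj1_sig z) (2 * PI)).

Definition poincare_is_identity (f : R -> R -> R) : Prop :=
  forall z : circle, poincare_map f z = z.

Definition torus_rhs (omega delta A B D : R) (theta tau : R) : R :=
  (cos theta + B + A * sin tau) / (omega * (1 - delta * cos tau)) + D.

(* Main.v *)
Require Import Defs.
From Stdlib Require Import Reals ZArith Lra Lia ClassicalEpsilon List.
From Coquelicot Require Import Coquelicot.

(** With [zeta = e^{i tau}] and [z = e^{i theta}], the equation on the torus becomes a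
    Riccati equation for [z], that is, the projectivisation of a linear system in
    two complex dimensions.  In the variable [zeta] this system is Fuchsian,
    [dY = (sum_p A_p d zeta / (zeta - p)) Y], with poles 0, [a], [1 / a] and infinity,
    where [0 < a < 1] and [a + 1 / a = 2 / delta].  If the Poincare map is the identity,
    then the linear holonomy of the unit circle has every vector [(e^{ix}, 1)] as an
    eigenvector, so it is scalar ([riccati_holonomy_scalar]); having determinant 1,
    it is [c = 1] or [c = -1].

    The unit circle surrounds the poles 0 and [a].  Since its holonomy is the scalar
    [c], the holonomies around 0 and around [a] are inverse to each other up to
    conjugation and the factor [c] ([join_trace]), and matrices of determinant 1 have
    the same trace as their inverses.  The trace of the holonomy around a pole with
    residue eigenvalues [lam] and [- lam] is [2 cos (2 pi lam)]
    ([shrinking_circle_trace]).  Therefore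
    [cos (2 pi lam_0) = c cos (2 pi lam_a)], which means that [2 lam_a] is
    [2 lam_0 - n] up to sign, for an integer [n] ([cosine_equation]).  The residues
    give, with [q = sqrt (1 - delta^2)],

      [2 lam_0 = D - i A / (omega delta)],
      [4 lam_a^2 = (B^2 - 1) / (omega q)^2 + 2 i A B / (omega^2 delta q) - A^2 / (omega delta)^2].

    Comparing the real parts of [4 lam_a^2 = (2 lam_0 - n)^2] gives
    [B^2 - 1 = omega^2 q^2 (D - n)^2].  Comparing the imaginary parts gives, when
    [A <> 0], [B^2 = omega^2 q^2 (D - n)^2], a contradiction
    ([torus_identity_parameters]).

    The topological input is the invariance of holonomy under homotopy.  It is
    obtained without holomorphic functions, for smooth families of paths: the
    derivative of the holonomy [G] with respect to the parameter of the family is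
    [Q_1 G - G Q_0], where [Q_0] and [Q_1] are the values of the connection on the
    velocities of the two end points ([holonomy_derive]).  A Gronwall estimate proves
    this, and also the continuity of the holonomy as circles shrink to a pole. *)

Open Scope R_scope.

(** * Mean value and Gronwall estimates *)

Section Mean_value.
Context {V : CompleteNormedModule R_AbsRing}.

(** The exponential weight is the point of this form of the mean value
    inequality: integrating it gains the factor [1 / L], which makes a Lipschitz
    integral operator a contraction, on intervals of any length, once [L]
    exceeds the Lipschitz constant. *)
Lemma exp_mean_value_right (f df : R -> V) (T A L : R) :
  0 < L ->
  (forall s, 0 <= s <= T -> is_derive f s (df s)) ->
  (forall s, 0 <= s <= T -> continuous df s) ->
  (forall s, 0 <= s <= T -> norm (df s) <= A * exp (L * s)) ->
  f 0 = zero ->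
  forall s, 0 <= s <= T -> norm (f s) <= A / L * exp (L * s).
Proof.
intros HL Hd Hc Hb H0 s Hs.
assert (HA : 0 <= A).
{ generalize (Hb s Hs) (norm_ge_0 (df s)) (exp_pos (L * s)); intros; nra. }
assert (Hf : is_RInt df 0 s (minus (f s) (f 0))).
{ apply is_RInt_derive; intros x Hx; rewrite Rmin_left, Rmax_right in Hx by lra;
  [apply Hd | apply Hc]; lra. }
assert (Hg : is_RInt (fun r => A * exp (L * r)) 0 s
   (minus (A / L * exp (L * s)) (A / L * exp (L * 0)))).
{ apply is_RInt_derive with (f := fun r => A / L * exp (L * r)).
  - intros x _. auto_derive; [easy | field; lra].
  - intros x _. apply (ex_derive_continuous (fun r => A * exp (L * r))).
    auto_derive; easy. }
generalize (norm_RInt_le _ _ 0 s _ _ (proj1 Hs)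
  (fun x Hx => Hb x (conj (proj1 Hx) (Rle_trans _ _ _ (proj2 Hx) (proj2 Hs)))) Hf Hg).
replace (minus (f s) (f 0)) with (f s)
  by (rewrite H0; symmetry; exact (minus_zero_r (G := CompleteNormedModule.AbelianGroup _ V) (f s))).
intros H. eapply Rle_trans. apply H.
unfold minus, plus, opp; simpl. rewrite Rmult_0_r, exp_0.
assert (0 <= A / L) by (apply Rdiv_le_0_compat; lra). lra.
Qed.

Lemma exp_mean_value (f df : R -> V) (T A L : R) :
  0 < L ->
  (forall s, is_derive f s (df s)) ->
  (forall s, continuous df s) ->
  (forall s, Rabs s <= T -> norm (df s) <= A * exp (L * Rabs s)) ->
  f 0 = zero ->
  forall s, Rabs s <= T -> norm (f s) <= A / L * exp (L * Rabs s).
Proof.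
intros HL Hd Hc Hb H0 s Hs.
destruct (Rle_lt_dec 0 s) as [Hp | Hn].
- rewrite Rabs_right in * by lra.
  apply exp_mean_value_right with (df := df) (T := T); try easy; try lra.
  intros r Hr. rewrite <- (Rabs_right r) at 2 by lra. apply Hb.
  rewrite Rabs_right; lra.
- rewrite Rabs_left in * by lra.
  replace (f s) with (f (- - s)) by (f_equal; ring).
  apply (exp_mean_value_right (fun r => f (- r)) (fun r => opp (df (- r))) T);
    try easy; try lra.
  + intros r _. assert (H1 : is_derive Ropp r (opp one)).
    { unfold opp, one; simpl. auto_derive; [easy | ring]. }
    evar_last. apply is_derive_comp. apply Hd. apply H1.
    now rewrite scal_opp_l, (scal_one (V := V)).
  + intros r _. apply (continuous_opp (fun r => df (- r))).
    apply continuous_comp. apply (ex_derive_continuous Ropp). auto_derive; easy.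
    apply Hc.
  + intros r Hr. eapply Rle_trans. apply Req_le, (norm_opp (V := V) (df (- r))).
    replace r with (Rabs (- r)) at 2 by (rewrite Rabs_Ropp, Rabs_right; lra).
    apply Hb. rewrite Rabs_Ropp, Rabs_right; lra.
  + now rewrite Ropp_0.
Qed.

(** Let [m] be the maximum of [exp (- 2 K s) * norm (f s)].  The mean value
    inequality with weight [L = 2 K] returns [m <= m / 2 + eps / (2 K)], hence
    [m <= eps / K]. *)
Lemma gronwall (f df : R -> V) (T K eps : R) :
  0 < K ->
  (forall s, 0 <= s <= T -> is_derive f s (df s)) ->
  (forall s, 0 <= s <= T -> continuous df s) ->
  (forall s, 0 <= s <= T -> norm (df s) <= K * norm (f s) + eps) ->
  f 0 = zero ->
  forall s, 0 <= s <= T -> norm (f s) <= eps / K * exp (2 * K * s).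
Proof.
intros HK Hd Hc Hb H0 s Hs.
set (g := fun r => exp (- (2 * K * r)) * norm (f r)).
destruct (continuity_ab_maj g 0 T) as [x [Hx Hx']].
{ lra. }
{ intros r Hr. apply continuity_pt_filterlim. unfold g.
  apply (continuous_mult (fun r => exp (- (2 * K * r))) (fun r => norm (f r))).
  - apply (ex_derive_continuous (fun r => exp (- (2 * K * r)))). auto_derive; easy.
  - apply continuous_comp. apply ex_derive_continuous. eexists. now apply Hd.
    apply filterlim_norm. }
set (m := g x) in *.
assert (Hm : forall r, 0 <= r <= T -> norm (f r) <= m * exp (2 * K * r)).
{ intros r Hr. generalize (Hx r Hr). unfold g. rewrite exp_Ropp.
  generalize (exp_pos (2 * K * r)). intros He H.
  apply Rmult_le_reg_l with (/ exp (2 * K * r)). now apply Rinv_0_lt_compat.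
  eapply Rle_trans. apply H. right. field. lra. }
assert (He : 0 <= eps).
{ assert (E : norm (f 0) = 0) by (rewrite H0; apply (norm_zero (V := V))).
  generalize (Hb 0 (conj (Rle_refl 0) (Rle_trans _ _ _ (proj1 Hs) (proj2 Hs)))) (norm_ge_0 (df 0)).
  rewrite E. lra. }
assert (H := exp_mean_value_right f df T (K * m + eps) (2 * K)
  (Rmult_lt_0_compat _ _ Rlt_0_2 HK) Hd Hc).
assert (H' : forall r, 0 <= r <= T ->
   norm (f r) <= (K * m + eps) / (2 * K) * exp (2 * K * r)).
{ apply H; [| easy]. intros r Hr.
  generalize (Hb r Hr) (Hm r Hr). intros.
  assert (1 <= exp (2 * K * r)).
  { generalize (exp_ineq1_le (2 * K * r)). nra. }
  nra. }
assert (Hm2 : m <= (K * m + eps) / (2 * K)).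
{ unfold m at 1, g. generalize (H' x Hx') (exp_pos (2 * K * x)). intros H1 H2.
  apply Rmult_le_reg_l with (exp (2 * K * x)); [easy |].
  rewrite exp_Ropp. rewrite <- Rmult_assoc, Rinv_r by lra. lra. }
assert (Hm3 : m <= eps / K).
{ replace ((K * m + eps) / (2 * K)) with (m / 2 + (eps / K) / 2) in Hm2 by (field; lra).
  lra. }
generalize (Hm s Hs) (exp_pos (2 * K * s)); intros; nra.
Qed.

Lemma ode_unique (F : R -> V -> V) (T K : R) (u v : R -> V) :
  (forall s x y, 0 <= s <= T ->
     norm (minus (F s x) (F s y)) <= K * norm (minus x y)) ->
  (forall s, 0 <= s <= T -> is_derive u s (F s (u s))) ->
  (forall s, 0 <= s <= T -> is_derive v s (F s (v s))) ->
  (forall s, 0 <= s <= T -> continuous (fun r => F r (u r)) s) ->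
  (forall s, 0 <= s <= T -> continuous (fun r => F r (v r)) s) ->
  u 0 = v 0 ->
  forall s, 0 <= s <= T -> u s = v s.
Proof.
intros HF Hu Hv Hcu Hcv H0 s Hs.
assert (H : norm (minus (u s) (v s)) <= 0 / (Rabs K + 1) * exp (2 * (Rabs K + 1) * s)).
{ apply (gronwall (fun r => minus (u r) (v r))
    (fun r => minus (F r (u r)) (F r (v r))) T); try easy.
  - generalize (Rabs_pos K); lra.
  - intros r Hr. apply (is_derive_minus u v); auto.
  - intros r Hr. apply (continuous_minus (fun r => F r (u r))); auto.
  - intros r Hr. eapply Rle_trans. apply HF; auto.
    generalize (Rle_abs K) (norm_ge_0 (minus (u r) (v r))); intros; nra.
  - rewrite H0. exact (minus_eq_zero (G := CompleteNormedModule.AbelianGroup _ V) (v 0)). }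
unfold Rdiv in H. rewrite !Rmult_0_l in H.
assert (H' : minus (u s) (v s) = zero).
{ apply (norm_eq_zero (V := V)). apply Rle_antisym; [easy | apply norm_ge_0]. }
apply (plus_reg_r (G := CompleteNormedModule.AbelianGroup _ V) (opp (v s))).
rewrite plus_opp_r. exact H'.
Qed.
End Mean_value.

(** * The global Picard-Lindelof theorem *)

Lemma bounded_on_segment (f : R -> R) (a b : R) :
  a <= b -> (forall s, a <= s <= b -> continuous f s) ->
  exists M, 0 < M /\ forall s, a <= s <= b -> f s <= M.
Proof.
intros Hab Hc. destruct (continuity_ab_maj f a b Hab) as [x [Hx _]].
{ intros c Hc'. apply continuity_pt_filterlim. now apply Hc. }
exists (Rabs (f x) + 1). split. generalize (Rabs_pos (f x)); lra.
intros s Hs. generalize (Hx s Hs) (Rle_abs (f x)); lra.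
Qed.

(** Picard iteration converges on the whole line: in the norm weighted by
    [exp (2 K |s|)] on [|s| <= T], one iteration halves distances, whatever [T].
    The limit is uniform on each of these intervals, so it is continuous, and it
    is a fixed point of the integral operator. *)
Section Picard.
Context {V : CompleteNormedModule R_AbsRing}.

Lemma norm_minus_triangle (a b c : V) :
  norm (minus a c) <= norm (minus a b) + norm (minus b c).
Proof.
eapply Rle_trans; [| apply (norm_triangle (V := V))].
apply Req_le, f_equal. exact (minus_trans (G := V) b a c).
Qed.

Lemma norm_minus_sym (a b : V) : norm (minus a b) = norm (minus b a).
Proof.
rewrite <- (norm_opp (V := V)). apply f_equal.
exact (opp_minus (G := V) a b).
Qed.

Lemma norm_minus_le_0_eq (a b : V) : norm (minus a b) <= 0 -> a = b.
Proof.
intros H. assert (H' : minus a b = zero).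
{ apply (norm_eq_zero (V := V)). apply Rle_antisym; [easy | apply norm_ge_0]. }
apply (plus_reg_r (G := CompleteNormedModule.AbelianGroup _ V) (opp b)).
rewrite plus_opp_r. exact H'.
Qed.

Context (F : R -> V -> V) (K : R) (x0 : V) (HK : 0 < K)
  (HL : forall s x y, norm (minus (F s x) (F s y)) <= K * norm (minus x y))
  (HC : forall u : R -> V, (forall s, continuous u s) ->
     forall s, continuous (fun r => F r (u r)) s).

Let step (u : R -> V) (s : R) : V := plus x0 (RInt (fun r => F r (u r)) 0 s).

Lemma step_derive (u : R -> V) : (forall s, continuous u s) ->
  forall s, is_derive (step u) s (F s (u s)).
Proof.
intros Hu s. unfold step.
evar_last.
- apply (is_derive_plus (fun _ => x0) (fun s => RInt (fun r => F r (u r)) 0 s)).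
  apply is_derive_const.
  apply is_derive_RInt with (f := fun r => F r (u r)) (a := 0).
  + apply filter_forall. intros b. apply (RInt_correct (fun r => F r (u r))).
    apply ex_RInt_continuous. intros z _. now apply HC.
  + now apply HC.
- apply plus_zero_l.
Qed.

Lemma step_continuous (u : R -> V) : (forall s, continuous u s) ->
  forall s, continuous (step u) s.
Proof.
intros Hu s. apply (ex_derive_continuous (V := V) (step u)).
eexists. now apply step_derive.
Qed.

Lemma step_0 u : step u 0 = x0.
Proof.
unfold step. rewrite (RInt_point (V := V)). exact (plus_zero_r (G := V) x0).
Qed.

Lemma step_contract (u v : R -> V) (T A : R) :
  (forall s, continuous u s) -> (forall s, continuous v s) ->
  (forall s, Rabs s <= T -> norm (minus (u s) (v s)) <= A * exp (2 * K * Rabs s)) ->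
  forall s, Rabs s <= T ->
    norm (minus (step u s) (step v s)) <= A / 2 * exp (2 * K * Rabs s).
Proof.
intros Hu Hv Hb s Hs.
replace (A / 2) with (K * A / (2 * K)) by (field; lra).
apply (exp_mean_value (fun s => minus (step u s) (step v s))
  (fun s => minus (F s (u s)) (F s (v s))) T); try lra; try easy.
- intros r. apply (is_derive_minus (step u) (step v)); now apply step_derive.
- intros r. apply (continuous_minus (fun s => F s (u s))); now apply HC.
- intros r Hr. eapply Rle_trans. apply HL. rewrite Rmult_assoc.
  apply Rmult_le_compat_l. lra. now apply Hb.
- rewrite !step_0. exact (minus_eq_zero (G := V) x0).
Qed.

Let it (n : nat) : R -> V := Nat.iter n step (fun _ => x0).

Lemma it_continuous n s : continuous (it n) s.
Proof.
revert s. induction n as [| n IH]; intros s; simpl.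
- apply continuous_const.
- now apply step_continuous.
Qed.

Lemma it_bound T : exists C, 0 < C /\ forall n m s, Rabs s <= T ->
  norm (minus (it (n + m) s) (it n s)) <= 2 * C / 2 ^ n * exp (2 * K * Rabs s).
Proof.
destruct (Rle_lt_dec 0 T) as [HT | HT].
2: { exists 1. split; [lra |]. intros n m s Hs. generalize (Rabs_pos s); lra. }
destruct (bounded_on_segment (fun s => norm (minus (it 1 s) (it 0 s))) (- T) T)
  as [C [HC0 HCb]]; [lra | |].
{ intros s _. apply (continuous_comp (fun s => minus (it 1 s) (it 0 s)) norm).
  apply (continuous_minus (it 1) (it 0)); apply it_continuous.
  apply (filterlim_norm (V := V)). }
exists C. split; [easy |].
assert (H1 : forall n s, Rabs s <= T ->
  norm (minus (it (S n) s) (it n s)) <= C / 2 ^ n * exp (2 * K * Rabs s)).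
{ induction n as [| n IH]; intros s Hs.
  - apply Rabs_le_between in Hs. generalize (HCb s Hs).
    generalize (exp_ineq1_le (2 * K * Rabs s)) (Rabs_pos s). intros.
    replace (C / 2 ^ 0) with C by (simpl; field).
    assert (0 <= 2 * K * Rabs s) by nra. nra.
  - replace (C / 2 ^ S n) with (C / 2 ^ n / 2)
      by (simpl; field; apply pow_nonzero; lra).
    apply (step_contract (it (S n)) (it n) T); auto using it_continuous. }
intros n m s Hs.
(* The difference of two geometric tails makes the induction on m go through. *)
assert (H2 : norm (minus (it (n + m) s) (it n s)) <=
  (2 * C / 2 ^ n - 2 * C / 2 ^ (n + m)) * exp (2 * K * Rabs s)).
{ induction m as [| m IH].
  - rewrite Nat.add_0_r. apply Req_le. rewrite Rminus_diag, Rmult_0_l.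
    rewrite (minus_eq_zero (G := V)). apply (norm_zero (V := V)).
  - rewrite Nat.add_succ_r. eapply Rle_trans.
    apply norm_minus_triangle with (b := it (n + m) s).
    generalize (H1 (n + m)%nat s Hs). intros H3.
    replace (2 * C / 2 ^ n - 2 * C / 2 ^ S (n + m)) with
      (C / 2 ^ (n + m) + (2 * C / 2 ^ n - 2 * C / 2 ^ (n + m)))
      by (simpl; field; split; apply pow_nonzero; lra).
    rewrite Rmult_plus_distr_r. now apply Rplus_le_compat. }
eapply Rle_trans. apply H2. apply Rmult_le_compat_r.
apply Rlt_le, exp_pos.
assert (0 < 2 * C / 2 ^ (n + m)).
{ apply Rdiv_lt_0_compat; [lra | apply pow_lt; lra]. }
lra.
Qed.

Lemma geom_small (A eps : R) : 0 < eps -> exists n, A / 2 ^ n < eps.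
Proof.
intros He.
assert (Hl : is_lim_seq (fun n => A * (/ 2) ^ n) (A * 0)).
{ apply is_lim_seq_mult'. apply is_lim_seq_const.
  apply is_lim_seq_geom. rewrite Rabs_right; lra. }
rewrite Rmult_0_r in Hl. apply is_lim_seq_spec in Hl.
destruct (Hl (mkposreal _ He)) as [n Hn].
exists n. generalize (Hn n (Nat.le_refl n)). simpl.
rewrite Rminus_0_r, pow_inv. intros H. eapply Rle_lt_trans; [apply Rle_abs | apply H].
Qed.

Lemma picard_lindelof :
  exists u : R -> V, u 0 = x0 /\ forall s, is_derive u s (F s (u s)).
Proof.
assert (Hex : forall s, exists y : V,
  forall eps, 0 < eps -> exists n0, forall n, (n0 <= n)%nat ->
    norm (minus (it n s) y) < eps).
{ intros s. destruct (it_bound (Rabs s)) as [C [HC0 HCb]].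
  assert (Hy : exists y : V, filterlim (fun n => it n s) eventually (locally y)).
  { apply (proj1 (filterlim_locally_cauchy (T := nat) (U := V) (F := eventually)
      (fun n => it n s))). intros eps.
    destruct (geom_small (2 * (2 * C * exp (2 * K * Rabs s))) eps) as [n Hn].
    { apply cond_pos. }
    exists (fun m => (n <= m)%nat). split. exists n; auto.
    intros i j Hi Hj. apply (norm_compat1 (V := V)).
    eapply Rle_lt_trans. apply norm_minus_triangle with (b := it n s).
    rewrite (norm_minus_sym (it n s)).
    replace i with (n + (i - n))%nat by lia. replace j with (n + (j - n))%nat by lia.
    generalize (HCb n (i - n)%nat s (Rle_refl _)) (HCb n (j - n)%nat s (Rle_refl _)).
    replace (2 * (2 * C * exp (2 * K * Rabs s)) / 2 ^ n) with
      (2 * C / 2 ^ n * exp (2 * K * Rabs s) + 2 * C / 2 ^ n * exp (2 * K * Rabs s))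
      in Hn by (field; apply pow_nonzero; lra).
    lra. }
  destruct Hy as [y Hy]. exists y. intros eps He.
  pose proof (proj1 (filterlim_locally_ball_norm (U := V) (F := eventually)
    (fun n => it n s) y) Hy) as Hb. clear Hy.
  destruct (Hb (mkposreal _ He)) as [n0 Hn0]. exists n0. intros n Hn.
  exact (Hn0 n Hn). }
apply ClassicalEpsilon.choice in Hex. destruct Hex as [u Hu].
assert (Hlim : forall T, exists C, 0 < C /\ forall n s, Rabs s <= T ->
  norm (minus (u s) (it n s)) <= 2 * C / 2 ^ n * exp (2 * K * Rabs s)).
{ intros T. destruct (it_bound T) as [C [HC0 HCb]]. exists C. split; [easy |].
  intros n s Hs. apply le_epsilon. intros eps He.
  destruct (Hu s eps He) as [m Hm].
  eapply Rle_trans. apply norm_minus_triangle with (b := it (n + m) s).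
  rewrite (norm_minus_sym (u s)).
  generalize (Hm (n + m)%nat ltac:(lia)) (HCb n m s Hs). lra. }
assert (Hc : forall s, continuous u s).
{ intros s. apply (filterlim_locally_ball_norm (U := V)). intros eps.
  destruct (Hlim (Rabs s + 1)) as [C [HC0 HCb]].
  destruct (geom_small (2 * C * exp (2 * K * (Rabs s + 1))) (eps / 3)) as [n Hn].
  { generalize (cond_pos eps); lra. }
  assert (HB : forall r, Rabs r <= Rabs s + 1 -> norm (minus (u r) (it n r)) < eps / 3).
  { intros r Hr. eapply Rle_lt_trans; [| apply Hn]. eapply Rle_trans. now apply HCb.
    replace (2 * C * exp (2 * K * (Rabs s + 1)) / 2 ^ n) with
      (2 * C / 2 ^ n * exp (2 * K * (Rabs s + 1))) by (field; apply pow_nonzero; lra).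
    apply Rmult_le_compat_l.
    - apply Rdiv_le_0_compat; [lra | apply pow_lt; lra].
    - destruct (Rle_lt_or_eq_dec _ _ Hr) as [H | H].
      + apply Rlt_le, exp_increasing. nra.
      + rewrite H. apply Rle_refl. }
  generalize (it_continuous n s). intros Hn'.
  assert (He3 : 0 < eps / 3) by (generalize (cond_pos eps); lra).
  pose proof (proj1 (filterlim_locally_ball_norm (U := V) (it n) (it n s)) Hn'
    (mkposreal _ He3)) as Hb.
  assert (H1 : locally s (fun r => Rabs r <= Rabs s + 1)).
  { exists (mkposreal 1 Rlt_0_1). intros r Hr.
    unfold ball in Hr; simpl in Hr. unfold AbsRing_ball, abs, minus, plus, opp in Hr; simpl in Hr.
    replace r with (s + (r + - s)) by ring. eapply Rle_trans. apply Rabs_triang. lra. }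
  generalize (filter_and _ _ Hb H1). apply filter_imp. intros r [Hr1 Hr2].
  unfold ball_norm in *. simpl in Hr1.
  eapply Rle_lt_trans. apply norm_minus_triangle with (b := it n r).
  eapply Rle_lt_trans. apply Rplus_le_compat_l.
  apply norm_minus_triangle with (b := it n s).
  pose proof (HB r Hr2) as H2. pose proof (HB s ltac:(lra)) as H3.
  rewrite norm_minus_sym in H3.
  assert (Hr3 : norm (minus (it n r) (it n s)) < eps / 3) by exact Hr1. lra. }
assert (Hfix : forall s, step u s = u s).
{ intros s. apply norm_minus_le_0_eq. apply le_epsilon. intros eps He.
  destruct (Hlim (Rabs s)) as [C [HC0 HCb]].
  destruct (geom_small (2 * C * exp (2 * K * Rabs s)) eps He) as [n Hn].
  eapply Rle_trans. apply norm_minus_triangle with (b := it (S n) s).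
  rewrite (norm_minus_sym _ (u s)).
  generalize (HCb (S n) s (Rle_refl _)).
  generalize (step_contract u (it n) (Rabs s) (2 * C / 2 ^ n) Hc
    (it_continuous n) (HCb n) s (Rle_refl _)).
  change (step (it n) s) with (it (S n) s).
  replace (2 * C / 2 ^ S n * exp (2 * K * Rabs s)) with
     (2 * C * exp (2 * K * Rabs s) / 2 ^ n / 2) by (simpl; field; apply pow_nonzero; lra).
  replace (2 * C / 2 ^ n / 2 * exp (2 * K * Rabs s)) with
     (2 * C * exp (2 * K * Rabs s) / 2 ^ n / 2) by (simpl; field; apply pow_nonzero; lra).
  lra. }
exists u. split. rewrite <- Hfix. apply step_0.
intros s. apply is_derive_ext with (step u). exact Hfix. now apply step_derive.
Qed.
End Picard.

(** * The space of complex 2 x 2 matrices *)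

Section Product_complete.
Context {K : AbsRing} {U V : CompleteNormedModule K}.

Let lim_prod (F : (U * V -> Prop) -> Prop) : U * V :=
  (lim (filtermap fst F), lim (filtermap snd F)).

Lemma complete_cauchy_prod (F : (U * V -> Prop) -> Prop) :
  ProperFilter F -> cauchy (T := prod_UniformSpace U V) F ->
  forall eps : posreal, F (ball (M := prod_UniformSpace U V) (lim_prod F) eps).
Proof.
intros HF Hc eps. apply filter_and.
- apply (complete_cauchy (T := U) (filtermap fst F)).
  + now apply filtermap_proper_filter.
  + intros e. destruct (Hc e) as [x Hx]. exists (fst x).
    unfold filtermap. generalize Hx. apply filter_imp. now intros y [Hy _].
- apply (complete_cauchy (T := V) (filtermap snd F)).
  + now apply filtermap_proper_filter.
  + intros e. destruct (Hc e) as [x Hx]. exists (snd x).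
    unfold filtermap. generalize Hx. apply filter_imp. now intros y [_ Hy].
Qed.

Lemma close_lim_prod (F1 F2 : (U * V -> Prop) -> Prop) :
  filter_le F1 F2 -> filter_le F2 F1 ->
  close (M := prod_UniformSpace U V) (lim_prod F1) (lim_prod F2).
Proof.
intros H1 H2 eps. split.
- apply (close_lim (T := U)); intros P; [apply H1 | apply H2].
- apply (close_lim (T := V)); intros P; [apply H1 | apply H2].
Qed.

Definition prod_CompleteSpace_mixin :=
  CompleteSpace.Mixin (prod_UniformSpace U V) lim_prod
    complete_cauchy_prod close_lim_prod.

Definition prod_CompleteNormedModule : CompleteNormedModule K :=
  CompleteNormedModule.Pack K (U * V)
    (CompleteNormedModule.Class K (U * V)
      (NormedModule.class K (prod_NormedModule K U V)) prod_CompleteSpace_mixin)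
    (U * V).
End Product_complete.

(** Complex numbers as a real normed space: paths are differentiated with respect
    to a real parameter. *)
Notation CR := C_R_CompleteNormedModule.

Definition M2 : CompleteNormedModule R_AbsRing :=
  @prod_CompleteNormedModule R_AbsRing
    (@prod_CompleteNormedModule R_AbsRing CR CR)
    (@prod_CompleteNormedModule R_AbsRing CR CR).

Definition mat (a b c d : C) : M2 := ((a, b), (c, d)).
Definition e11 (A : M2) : C := fst (fst A).
Definition e12 (A : M2) : C := snd (fst A).
Definition e21 (A : M2) : C := fst (snd A).
Definition e22 (A : M2) : C := snd (snd A).

Definition mmul (A B : M2) : M2 :=
  mat (e11 A * e11 B + e12 A * e21 B)%C (e11 A * e12 B + e12 A * e22 B)%C
      (e21 A * e11 B + e22 A * e21 B)%C (e21 A * e12 B + e22 A * e22 B)%C.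

Definition mscal (c : C) (A : M2) : M2 :=
  mat (c * e11 A)%C (c * e12 A)%C (c * e21 A)%C (c * e22 A)%C.

Definition mone : M2 := mat 1 0 0 1.
Definition mtr (A : M2) : C := (e11 A + e22 A)%C.
Definition mdet (A : M2) : C := (e11 A * e22 A - e12 A * e21 A)%C.
Definition madj (A : M2) : M2 := mat (e22 A) (- e12 A)%C (- e21 A)%C (e11 A).

Lemma mat_ext (A B : M2) :
  e11 A = e11 B -> e12 A = e12 B -> e21 A = e21 B -> e22 A = e22 B -> A = B.
Proof.
destruct A as [[a b] [c d]], B as [[a' b'] [c' d']]. unfold e11, e12, e21, e22; simpl.
now intros -> -> -> ->.
Qed.

Lemma mplus_mat (A B : M2) : plus A B =
  mat (e11 A + e11 B) (e12 A + e12 B) (e21 A + e21 B) (e22 A + e22 B).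
Proof. reflexivity. Qed.
Lemma mopp_mat (A : M2) : opp A = mat (- e11 A) (- e12 A) (- e21 A) (- e22 A).
Proof. reflexivity. Qed.
Lemma mzero_mat : (zero : M2) = mat 0 0 0 0.
Proof. reflexivity. Qed.
Lemma mscalR_mat (r : R) (A : M2) : scal r A =
  mat (RtoC r * e11 A) (RtoC r * e12 A) (RtoC r * e21 A) (RtoC r * e22 A).
Proof.
apply mat_ext; unfold e11, e12, e21, e22; simpl; symmetry; apply injective_projections; simpl;
  unfold scal; simpl; unfold mult; simpl; ring.
Qed.

Ltac mring := apply mat_ext; unfold mmul, mscal, madj, mone, minus;
  rewrite ?mplus_mat, ?mopp_mat, ?mzero_mat, ?mscalR_mat;
  unfold mat, e11, e12, e21, e22; simpl.

Lemma mmul_assoc A B D : mmul A (mmul B D) = mmul (mmul A B) D.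
Proof. mring; ring. Qed.
Lemma mmul_plus_l A B D : mmul (plus A B) D = plus (mmul A D) (mmul B D).
Proof. mring; ring. Qed.
Lemma mmul_plus_r A B D : mmul D (plus A B) = plus (mmul D A) (mmul D B).
Proof. mring. all: ring. Qed.

(** * Continuity and differentiation of complex and matrix functions *)

Lemma norm_CR (z : CR) : norm z = Cmod z.
Proof.
destruct z as [x y]. unfold Cmod, norm; simpl. unfold prod_norm, norm; simpl.
unfold abs; simpl. f_equal.
rewrite !Rmult_1_r, <- !Rabs_mult, !Rabs_right; nra.
Qed.

Lemma Cmod_e11 (A : M2) : Cmod (e11 A) <= norm A.
Proof.
rewrite <- norm_CR. eapply Rle_trans.
apply (norm_le_prod_norm_1 (U := CR) (V := CR) (fst A)).
apply (norm_le_prod_norm_1 (U := @prod_CompleteNormedModule R_AbsRing CR CR)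
  (V := @prod_CompleteNormedModule R_AbsRing CR CR) A).
Qed.
Lemma Cmod_e12 (A : M2) : Cmod (e12 A) <= norm A.
Proof.
rewrite <- norm_CR. eapply Rle_trans.
apply (norm_le_prod_norm_2 (U := CR) (V := CR) (fst A)).
apply (norm_le_prod_norm_1 (U := @prod_CompleteNormedModule R_AbsRing CR CR)
  (V := @prod_CompleteNormedModule R_AbsRing CR CR) A).
Qed.
Lemma Cmod_e21 (A : M2) : Cmod (e21 A) <= norm A.
Proof.
rewrite <- norm_CR. eapply Rle_trans.
apply (norm_le_prod_norm_1 (U := CR) (V := CR) (snd A)).
apply (norm_le_prod_norm_2 (U := @prod_CompleteNormedModule R_AbsRing CR CR)
  (V := @prod_CompleteNormedModule R_AbsRing CR CR) A).
Qed.
Lemma Cmod_e22 (A : M2) : Cmod (e22 A) <= norm A.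
Proof.
rewrite <- norm_CR. eapply Rle_trans.
apply (norm_le_prod_norm_2 (U := CR) (V := CR) (snd A)).
apply (norm_le_prod_norm_2 (U := @prod_CompleteNormedModule R_AbsRing CR CR)
  (V := @prod_CompleteNormedModule R_AbsRing CR CR) A).
Qed.

Lemma norm_pair_le {U V : NormedModule R_AbsRing} (x : U) (y : V) :
  norm ((x, y) : prod_NormedModule R_AbsRing U V) <= norm x + norm y.
Proof.
unfold norm at 1; simpl. unfold prod_norm; simpl.
generalize (norm_ge_0 x) (norm_ge_0 y). intros Hx Hy.
rewrite <- (sqrt_pow2 (norm x + norm y)) by lra.
apply sqrt_le_1_alt. nra.
Qed.

Lemma norm_mat_le (A : M2) :
  norm A <= Cmod (e11 A) + Cmod (e12 A) + Cmod (e21 A) + Cmod (e22 A).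
Proof.
destruct A as [[a b] [c d]]. unfold e11, e12, e21, e22; simpl.
rewrite <- !norm_CR.
eapply Rle_trans.
apply (norm_pair_le (U := @prod_CompleteNormedModule R_AbsRing CR CR)
  (V := @prod_CompleteNormedModule R_AbsRing CR CR) (a, b) (c, d)).
generalize (norm_pair_le (U := CR) (V := CR) a b) (norm_pair_le (U := CR) (V := CR) c d).
intros H1 H2. rewrite (Rplus_assoc (_ + _)).
apply Rplus_le_compat; [apply H1 | apply H2].
Qed.

Lemma norm_mmul (A B : M2) : norm (mmul A B) <= 8 * (norm A * norm B).
Proof.
assert (H : forall a b c d : C, Cmod a <= norm A -> Cmod c <= norm A ->
  Cmod b <= norm B -> Cmod d <= norm B ->
  Cmod (a * b + c * d)%C <= 2 * (norm A * norm B)).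
{ intros a b c d Ha Hc Hb Hd. eapply Rle_trans. apply Cmod_triangle.
  rewrite !Cmod_mult.
  generalize (Rmult_le_compat _ _ _ _ (Cmod_ge_0 a) (Cmod_ge_0 b) Ha Hb).
  generalize (Rmult_le_compat _ _ _ _ (Cmod_ge_0 c) (Cmod_ge_0 d) Hc Hd). lra. }
eapply Rle_trans. apply norm_mat_le.
generalize (Cmod_e11 A) (Cmod_e12 A) (Cmod_e21 A) (Cmod_e22 A)
  (Cmod_e11 B) (Cmod_e12 B) (Cmod_e21 B) (Cmod_e22 B). intros.
replace (8 * (norm A * norm B)) with (2 * (norm A * norm B) + 2 * (norm A * norm B)
  + 2 * (norm A * norm B) + 2 * (norm A * norm B)) by ring.
repeat apply Rplus_le_compat; apply H; assumption.
Qed.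

Section Cont.
Context {T : UniformSpace}.

Lemma continuous_pair {U V : UniformSpace} (f : T -> U) (g : T -> V) (x : T) :
  continuous f x -> continuous g x ->
  continuous (U := prod_UniformSpace U V) (fun t => (f t, g t)) x.
Proof.
intros Hf Hg. apply filterlim_locally. intros eps.
generalize (filter_and _ _ (proj1 (filterlim_locally _ _) Hf eps)
  (proj1 (filterlim_locally _ _) Hg eps)).
apply filter_imp. intros y [H1 H2]. now split.
Qed.

Lemma continuous_C (f : T -> C) x :
  continuous (fun t => fst (f t)) x -> continuous (fun t => snd (f t)) x ->
  continuous f x.
Proof.
intros H1 H2. apply continuous_ext with (fun t => (fst (f t), snd (f t))).
intros t; symmetry; apply surjective_pairing.
now apply (continuous_pair (U := R_UniformSpace) (V := R_UniformSpace)).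
Qed.

Lemma continuous_Re (f : T -> C) x : continuous f x -> continuous (fun t => fst (f t)) x.
Proof.
intros H. apply (continuous_comp f fst x H).
destruct (f x). apply (continuous_fst (U := R_UniformSpace) (V := R_UniformSpace)).
Qed.
Lemma continuous_Im (f : T -> C) x : continuous f x -> continuous (fun t => snd (f t)) x.
Proof.
intros H. apply (continuous_comp f snd x H).
destruct (f x). apply (continuous_snd (U := R_UniformSpace) (V := R_UniformSpace)).
Qed.

Lemma continuous_Cplus (f g : T -> C) x :
  continuous f x -> continuous g x -> continuous (fun t => f t + g t)%C x.
Proof.
intros Hf Hg. apply continuous_C; simpl;
apply (continuous_plus (V := R_NormedModule));
 auto using continuous_Re, continuous_Im.
Qed.
Lemma continuous_Copp (f : T -> C) x : continuous f x -> continuous (fun t => - f t)%C x.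
Proof.
intros Hf. apply continuous_C; simpl;
apply (continuous_opp (V := R_NormedModule)); auto using continuous_Re, continuous_Im.
Qed.
Lemma continuous_Cminus (f g : T -> C) x :
  continuous f x -> continuous g x -> continuous (fun t => f t - g t)%C x.
Proof. intros Hf Hg. apply continuous_Cplus; [easy | now apply continuous_Copp]. Qed.
Lemma continuous_Cmult (f g : T -> C) x :
  continuous f x -> continuous g x -> continuous (fun t => f t * g t)%C x.
Proof.
intros Hf Hg. apply continuous_C; simpl;
[apply (continuous_minus (V := R_NormedModule)) | apply (continuous_plus (V := R_NormedModule))];
apply (continuous_mult (K := R_AbsRing)); auto using continuous_Re, continuous_Im.
Qed.
Lemma Cnormsq_pos (z : C) : z <> 0 -> 0 < fst z ^ 2 + snd z ^ 2.
Proof.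
intros Hz. destruct (Rle_lt_dec (fst z ^ 2 + snd z ^ 2) 0) as [H | H]; [| easy].
exfalso. apply Hz. destruct z as [a b]; simpl in *.
apply injective_projections; simpl; nra.
Qed.
Lemma continuous_Cinv (f : T -> C) x :
  f x <> 0 -> continuous f x -> continuous (fun t => / f t)%C x.
Proof.
intros H0 Hf. apply Cnormsq_pos in H0.
assert (Hn : continuous (fun t => / (fst (f t) ^ 2 + snd (f t) ^ 2)) x).
{ apply (continuous_comp (fun t => fst (f t) ^ 2 + snd (f t) ^ 2) Rinv);
    [| apply continuous_Rinv; lra].
  apply (continuous_plus (V := R_NormedModule)); simpl;
  apply (continuous_mult (K := R_AbsRing)); auto using continuous_Re, continuous_Im;
  apply (continuous_mult (K := R_AbsRing)); auto using continuous_Re, continuous_Im;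
  apply continuous_const. }
apply continuous_C; simpl; unfold Rdiv;
apply (continuous_mult (K := R_AbsRing)); auto using continuous_Re, continuous_Im.
apply (continuous_opp (V := R_NormedModule)). auto using continuous_Im.
Qed.

Lemma continuous_mat (f : T -> M2) x :
  continuous (fun t => e11 (f t)) x -> continuous (fun t => e12 (f t)) x ->
  continuous (fun t => e21 (f t)) x -> continuous (fun t => e22 (f t)) x ->
  continuous f x.
Proof.
intros. apply continuous_ext with (fun t => mat (e11 (f t)) (e12 (f t)) (e21 (f t)) (e22 (f t))).
intros t; now apply mat_ext.
apply (continuous_pair (U := prod_UniformSpace C_UniformSpace C_UniformSpace)
  (V := prod_UniformSpace C_UniformSpace C_UniformSpace));
now apply (continuous_pair (U := C_UniformSpace) (V := C_UniformSpace)).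
Qed.
Lemma continuous_entries (f : T -> M2) x : continuous f x ->
  continuous (fun t => e11 (f t)) x /\ continuous (fun t => e12 (f t)) x /\
  continuous (fun t => e21 (f t)) x /\ continuous (fun t => e22 (f t)) x.
Proof.
intros H.
assert (H1 : continuous (U := prod_UniformSpace C_UniformSpace C_UniformSpace) (fun t => fst (f t)) x).
{ apply (continuous_comp f fst x H). destruct (f x). 
  apply (continuous_fst (U := prod_UniformSpace C_UniformSpace C_UniformSpace) (V := prod_UniformSpace C_UniformSpace C_UniformSpace)). }
assert (H2 : continuous (U := prod_UniformSpace C_UniformSpace C_UniformSpace) (fun t => snd (f t)) x).
{ apply (continuous_comp f snd x H). destruct (f x). 
  apply (continuous_snd (U := prod_UniformSpace C_UniformSpace C_UniformSpace) (V := prod_UniformSpace C_UniformSpace C_UniformSpace)). }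
repeat split.
- apply (continuous_comp _ fst x H1). destruct (fst (f x)).
  apply (continuous_fst (U := C_UniformSpace) (V := C_UniformSpace)).
- apply (continuous_comp _ snd x H1). destruct (fst (f x)).
  apply (continuous_snd (U := C_UniformSpace) (V := C_UniformSpace)).
- apply (continuous_comp _ fst x H2). destruct (snd (f x)).
  apply (continuous_fst (U := C_UniformSpace) (V := C_UniformSpace)).
- apply (continuous_comp _ snd x H2). destruct (snd (f x)).
  apply (continuous_snd (U := C_UniformSpace) (V := C_UniformSpace)).
Qed.

Lemma continuous_mmul (f g : T -> M2) x :
  continuous f x -> continuous g x -> continuous (fun t => mmul (f t) (g t)) x.
Proof.
intros Hf Hg. apply continuous_entries in Hf, Hg.
apply continuous_mat; apply continuous_Cplus; apply continuous_Cmult; tauto.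
Qed.
Lemma continuous_mscal (c : T -> C) (g : T -> M2) x :
  continuous c x -> continuous g x -> continuous (fun t => mscal (c t) (g t)) x.
Proof.
intros Hf Hg. apply continuous_entries in Hg.
apply continuous_mat; apply continuous_Cmult; tauto.
Qed.
End Cont.

Lemma is_derive_linear {U V : NormedModule R_AbsRing} (l : U -> V) (f : R -> U) x d :
  is_linear l -> is_derive f x d -> is_derive (fun t => l (f t)) x (l d).
Proof.
intros Hl Hf. unfold is_derive in *.
apply filterdiff_ext_lin with (fun y => l (scal y d)).
- apply (filterdiff_comp' f l x (fun y => scal y d) l Hf).
  now apply filterdiff_linear.
- intros y. now apply linear_scal.
Qed.

Lemma is_derive_pair {U V : NormedModule R_AbsRing} (f : R -> U) (g : R -> V) x a b :
  is_derive f x a -> is_derive g x b ->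
  is_derive (V := prod_NormedModule R_AbsRing U V) (fun t => (f t, g t)) x (a, b).
Proof.
intros Hf Hg. unfold is_derive in *.
apply (filterdiff_comp'_2 (W := prod_NormedModule R_AbsRing U V) f g pair x
  (fun y => scal y a) (fun y => scal y b) pair Hf Hg).
apply (filterdiff_ext (fun t => t)). now intros [].
apply filterdiff_ext_lin with (fun t => t). apply filterdiff_id. now intros [].
Qed.

Notation is_Cderive := (@is_derive R_AbsRing C_R_NormedModule).

Lemma is_derive_C (f : R -> C) x (d : C) :
  is_derive (fun t => fst (f t)) x (fst d) -> is_derive (fun t => snd (f t)) x (snd d) ->
  is_Cderive f x d.
Proof.
intros H1 H2. apply (is_derive_ext (fun t => (fst (f t), snd (f t)))).
intros t; symmetry; apply surjective_pairing.
rewrite (surjective_pairing d).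
now apply (is_derive_pair (U := R_NormedModule) (V := R_NormedModule)).
Qed.
Lemma is_derive_Re (f : R -> C) x d : is_Cderive f x d -> is_derive (fun t => fst (f t)) x (fst d).
Proof.
apply (is_derive_linear (U := C_R_NormedModule) (V := R_NormedModule) fst).
apply (is_linear_fst (U := R_NormedModule) (V := R_NormedModule)).
Qed.
Lemma is_derive_Im (f : R -> C) x d : is_Cderive f x d -> is_derive (fun t => snd (f t)) x (snd d).
Proof.
apply (is_derive_linear (U := C_R_NormedModule) (V := R_NormedModule) snd).
apply (is_linear_snd (U := R_NormedModule) (V := R_NormedModule)).
Qed.

Lemma is_derive_Cplus (f g : R -> C) x a b :
  is_Cderive f x a -> is_Cderive g x b -> is_Cderive (fun t => f t + g t)%C x (a + b)%C.
Proof. apply (is_derive_plus (V := C_R_NormedModule)). Qed.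
Lemma is_derive_Cminus (f g : R -> C) x a b :
  is_Cderive f x a -> is_Cderive g x b -> is_Cderive (fun t => f t - g t)%C x (a - b)%C.
Proof. apply (is_derive_minus (V := C_R_NormedModule)). Qed.
Lemma is_derive_Cmult (f g : R -> C) x a b :
  is_Cderive f x a -> is_Cderive g x b ->
  is_Cderive (fun t => f t * g t)%C x (a * g x + f x * b)%C.
Proof.
intros Hf Hg.
apply is_derive_Re in Hf as Hf1. apply is_derive_Im in Hf as Hf2.
apply is_derive_Re in Hg as Hg1. apply is_derive_Im in Hg as Hg2.
apply is_derive_C; simpl.
- evar_last. apply (is_derive_minus (V := R_NormedModule));
  apply (is_derive_mult (K := R_AbsRing)); eauto; intros; apply Rmult_comm.
  unfold minus, plus, mult, opp; simpl. ring.
- evar_last. apply (is_derive_plus (V := R_NormedModule));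
  apply (is_derive_mult (K := R_AbsRing)); eauto; intros; apply Rmult_comm.
  unfold minus, plus, mult, opp; simpl. ring.
Qed.
Lemma is_derive_Cinv (f : R -> C) x a :
  f x <> 0 -> is_Cderive f x a -> is_Cderive (fun t => / f t)%C x (- a / (f x * f x))%C.
Proof.
intros H0 Hf. apply Cnormsq_pos in H0 as Hn.
apply is_derive_Re in Hf as Hf1. apply is_derive_Im in Hf as Hf2.
replace (- a / (f x * f x))%C with
  ((fst a * (fst (f x) ^ 2 + snd (f x) ^ 2) - fst (f x) *
      (2 * fst (f x) * fst a + 2 * snd (f x) * snd a)) / (fst (f x) ^ 2 + snd (f x) ^ 2) ^ 2,
   (- snd a * (fst (f x) ^ 2 + snd (f x) ^ 2) - - snd (f x) *
      (2 * fst (f x) * fst a + 2 * snd (f x) * snd a)) / (fst (f x) ^ 2 + snd (f x) ^ 2) ^ 2).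
2: { destruct (f x) as [u v], a as [a b]; simpl in Hn.
     assert ((u * u - v * v) * (u * u - v * v) + (u * v + v * u) * (u * v + v * u) <> 0).
     { replace (_ + _) with ((u ^ 2 + v ^ 2) ^ 2) by ring. apply Rgt_not_eq. now apply pow_lt. }
     apply injective_projections; simpl; field; split; nra. }
assert (Hd : is_derive (fun t => fst (f t) ^ 2 + snd (f t) ^ 2) x
   (2 * fst (f x) * fst a + 2 * snd (f x) * snd a)).
{ evar_last. apply (is_derive_plus (V := R_NormedModule)); apply is_derive_pow; eassumption.
  unfold plus; simpl. ring. }
apply is_derive_C.
- apply (is_derive_div (fun t => fst (f t)) (fun t => fst (f t) ^ 2 + snd (f t) ^ 2));
  try easy; lra.
- apply (is_derive_div (fun t => - snd (f t)) (fun t => fst (f t) ^ 2 + snd (f t) ^ 2));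
  try easy; [| lra].
  apply (is_derive_opp (V := R_NormedModule) _ _ _ Hf2).
Qed.

Notation is_Mderive := (@is_derive R_AbsRing M2).
Lemma is_derive_mat (f : R -> M2) x (d : M2) :
  is_Cderive (fun t => e11 (f t)) x (e11 d) -> is_Cderive (fun t => e12 (f t)) x (e12 d) ->
  is_Cderive (fun t => e21 (f t)) x (e21 d) -> is_Cderive (fun t => e22 (f t)) x (e22 d) ->
  is_Mderive f x d.
Proof.
intros H1 H2 H3 H4.
apply (is_derive_ext (V := M2) (fun t => mat (e11 (f t)) (e12 (f t)) (e21 (f t)) (e22 (f t)))).
intros t; now apply mat_ext.
replace d with (mat (e11 d) (e12 d) (e21 d) (e22 d)) by now apply mat_ext.
apply (is_derive_pair (U := prod_NormedModule R_AbsRing CR CR)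
   (V := prod_NormedModule R_AbsRing CR CR));
now apply (is_derive_pair (U := CR) (V := CR)).
Qed.
Lemma is_derive_entries (f : R -> M2) x (d : M2) : is_Mderive f x d ->
  is_Cderive (fun t => e11 (f t)) x (e11 d) /\ is_Cderive (fun t => e12 (f t)) x (e12 d) /\
  is_Cderive (fun t => e21 (f t)) x (e21 d) /\ is_Cderive (fun t => e22 (f t)) x (e22 d).
Proof.
intros H.
assert (H1 : @is_derive R_AbsRing (prod_NormedModule R_AbsRing CR CR) (fun t => fst (f t)) x (fst d)).
{ apply (is_derive_linear (U := M2) (V := prod_NormedModule R_AbsRing CR CR) fst); [| easy].
  apply (is_linear_fst (U := prod_NormedModule R_AbsRing CR CR) (V := prod_NormedModule R_AbsRing CR CR)). }
assert (H2 : @is_derive R_AbsRing (prod_NormedModule R_AbsRing CR CR) (fun t => snd (f t)) x (snd d)).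
{ apply (is_derive_linear (U := M2) (V := prod_NormedModule R_AbsRing CR CR) snd); [| easy].
  apply (is_linear_snd (U := prod_NormedModule R_AbsRing CR CR) (V := prod_NormedModule R_AbsRing CR CR)). }
split; [| split; [| split]].
- exact (is_derive_linear (U := prod_NormedModule R_AbsRing CR CR) (V := CR) fst _ x _
    (is_linear_fst (U := CR) (V := CR)) H1).
- exact (is_derive_linear (U := prod_NormedModule R_AbsRing CR CR) (V := CR) snd _ x _
    (is_linear_snd (U := CR) (V := CR)) H1).
- exact (is_derive_linear (U := prod_NormedModule R_AbsRing CR CR) (V := CR) fst _ x _
    (is_linear_fst (U := CR) (V := CR)) H2).
- exact (is_derive_linear (U := prod_NormedModule R_AbsRing CR CR) (V := CR) snd _ x _
    (is_linear_snd (U := CR) (V := CR)) H2).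
Qed.

Lemma is_derive_mmul (f g : R -> M2) x a b :
  is_Mderive f x a -> is_Mderive g x b ->
  is_Mderive (fun t => mmul (f t) (g t)) x (plus (mmul a (g x)) (mmul (f x) b)).
Proof.
intros Hf Hg. apply is_derive_entries in Hf, Hg.
destruct Hf as (F1 & F2 & F3 & F4), Hg as (G1 & G2 & G3 & G4).
apply is_derive_mat; (evar_last;
 [apply is_derive_Cplus; apply is_derive_Cmult; eassumption |
  rewrite mplus_mat; unfold mmul, mat, e11, e12, e21, e22; simpl; ring]).
Qed.

(** * Linear matrix equations *)

Lemma norm_bounded (f : R -> M2) (T : R) :
  0 <= T -> (forall s, 0 <= s <= T -> continuous f s) ->
  exists M, 0 < M /\ forall s, 0 <= s <= T -> norm (f s) <= M.
Proof.
intros HT Hf. apply bounded_on_segment; [easy |].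
intros s Hs. apply continuous_comp. now apply Hf. apply (filterlim_norm (V := M2)).
Qed.

Lemma Mderive_continuous (f : R -> M2) s d : is_Mderive f s d -> continuous f s.
Proof. intros H. apply (ex_derive_continuous (V := M2)). now exists d. Qed.

(** Equations are required on [0, T], but with two-sided derivatives at the end
    points: solutions come from equations on the whole line. *)
Definition solves (P : R -> M2) (T : R) (U : R -> M2) : Prop :=
  U 0 = mone /\ forall s, 0 <= s <= T -> is_Mderive U s (mmul (P s) (U s)).

(** Freezing the coefficient outside the interval reduces a linear equation on
    [0, T] to one on the whole line with a bounded coefficient. *)
Definition clamp (T s : R) : R := Rmax 0 (Rmin s T).

Lemma clamp_id T s : 0 <= s <= T -> clamp T s = s.
Proof. intros Hs. unfold clamp. rewrite Rmin_left, Rmax_right; lra. Qed.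

Lemma clamp_range T s : 0 <= T -> 0 <= clamp T s <= T.
Proof.
intros HT. unfold clamp. split. apply Rmax_l.
apply Rmax_lub; [easy | apply Rmin_r].
Qed.

Lemma continuous_clamp T s : continuous (clamp T) s.
Proof.
(* max and min as half-sums with an absolute value *)
apply continuous_ext with (fun s => (0 + ((s + T - Rabs (s - T)) / 2) + Rabs (0 - (s + T - Rabs (s - T)) / 2)) / 2).
{ intros x. unfold clamp, Rmax, Rmin.
  destruct (Rle_dec x T); destruct (Rle_dec 0 _);
  unfold Rabs; repeat destruct Rcase_abs; lra. }
apply continuity_pt_filterlim. reg.
Qed.

Lemma mmul_minus_r A B D : mmul D (minus A B) = minus (mmul D A) (mmul D B).
Proof. mring; ring. Qed.

Lemma linear_ode_exists (P : R -> M2) (T : R) :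
  0 <= T -> (forall s, 0 <= s <= T -> continuous P s) ->
  exists U, solves P T U.
Proof.
intros HT HP. destruct (norm_bounded P T HT HP) as [M [HM0 HM]].
destruct (picard_lindelof (V := M2) (fun s X => mmul (P (clamp T s)) X) (8 * M) mone)
  as [U [HU0 HU]].
- lra.
- intros s X Y. rewrite <- mmul_minus_r. eapply Rle_trans. apply norm_mmul.
  generalize (HM _ (clamp_range T s HT)) (norm_ge_0 (minus X Y)). intros.
  rewrite Rmult_assoc. apply Rmult_le_compat_l; [lra |]. now apply Rmult_le_compat_r.
- intros u Hu s. apply continuous_mmul; [| apply Hu].
  apply (continuous_comp (clamp T) P). apply continuous_clamp.
  apply HP. now apply clamp_range.
- exists U. split; [easy |]. intros s Hs. generalize (HU s). now rewrite clamp_id.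
Qed.

Lemma linear_ode_unique (P : R -> M2) (T : R) (X Y : R -> M2) :
  (forall s, 0 <= s <= T -> continuous P s) ->
  (forall s, 0 <= s <= T -> is_Mderive X s (mmul (P s) (X s))) ->
  (forall s, 0 <= s <= T -> is_Mderive Y s (mmul (P s) (Y s))) ->
  X 0 = Y 0 -> forall s, 0 <= s <= T -> X s = Y s.
Proof.
intros HP HX HY H0 s Hs.
destruct (norm_bounded P T ltac:(lra) HP) as [M [HM0 HM]].
apply (ode_unique (V := M2) (fun s X => mmul (P s) X) T (8 * M)); try easy.
- intros r A B Hr. rewrite <- mmul_minus_r. eapply Rle_trans. apply norm_mmul.
  generalize (HM r Hr) (norm_ge_0 (minus A B)). intros.
  rewrite Rmult_assoc. apply Rmult_le_compat_l; [lra |]. now apply Rmult_le_compat_r.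
- intros r Hr. apply continuous_mmul. now apply HP. eapply Mderive_continuous. now apply HX.
- intros r Hr. apply continuous_mmul. now apply HP. eapply Mderive_continuous. now apply HY.
Qed.

(** The constant depends on [P0] and [T] only, so the bound is uniform over all
    coefficients near [P0]. *)
Lemma linear_ode_bound (P0 : R -> M2) (T : R) :
  0 <= T -> (forall s, 0 <= s <= T -> continuous P0 s) ->
  exists c, 0 < c /\ forall (P D E : R -> M2) (eta : R),
  (forall s, 0 <= s <= T -> continuous P s) ->
  (forall s, 0 <= s <= T -> norm (minus (P s) (P0 s)) <= 1) ->
  (forall s, 0 <= s <= T -> continuous E s) ->
  (forall s, 0 <= s <= T -> norm (E s) <= eta) ->
  D 0 = zero ->
  (forall s, 0 <= s <= T -> is_Mderive D s (plus (mmul (P s) (D s)) (E s))) ->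
  forall s, 0 <= s <= T -> norm (D s) <= c * eta.
Proof.
intros HT HP0. destruct (norm_bounded P0 T HT HP0) as [M [HM0 HM]].
set (K := 8 * (M + 1)). exists (/ K * exp (2 * K * T)).
assert (HK : 0 < K) by (unfold K; lra).
split. apply Rmult_lt_0_compat. now apply Rinv_0_lt_compat. apply exp_pos.
intros P D E eta HP HPP HE HEb HD0 HD s Hs.
assert (Heta : 0 <= eta).
{ eapply Rle_trans. apply (norm_ge_0 (E s)). now apply HEb. }
assert (HPb : forall r, 0 <= r <= T -> norm (P r) <= M + 1).
{ intros r Hr. replace (P r) with (plus (minus (P r) (P0 r)) (P0 r)) by (mring; ring).
  eapply Rle_trans. apply (norm_triangle (V := M2)). rewrite Rplus_comm.
  apply Rplus_le_compat; auto. }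
eapply Rle_trans.
apply (gronwall (V := M2) D (fun s => plus (mmul (P s) (D s)) (E s)) T K eta); try easy.
- intros r Hr. apply (continuous_plus (V := M2)); [| now apply HE].
  apply continuous_mmul. now apply HP. eapply Mderive_continuous. now apply HD.
- intros r Hr. eapply Rle_trans. apply (norm_triangle (V := M2)).
  apply Rplus_le_compat; [| now apply HEb].
  eapply Rle_trans. apply norm_mmul. unfold K. rewrite Rmult_assoc.
  apply Rmult_le_compat_l. lra. apply Rmult_le_compat_r. apply norm_ge_0.
  now apply HPb.
- unfold Rdiv. rewrite (Rmult_comm eta), !Rmult_assoc, (Rmult_comm eta).
  apply Rmult_le_compat_l. now apply Rlt_le, Rinv_0_lt_compat.
  apply Rmult_le_compat_r. easy.
  destruct (Rle_lt_or_eq_dec s T (proj2 Hs)) as [H | ->]; [| apply Rle_refl].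
  apply Rlt_le, exp_increasing. nra.
Qed.

(** The difference of the two solutions solves the equation of [P] with forcing
    [(P - P0) U0]. *)
Lemma linear_ode_perturbation (P0 U0 : R -> M2) (T : R) :
  0 <= T -> (forall s, 0 <= s <= T -> continuous P0 s) -> solves P0 T U0 ->
  exists c, 0 < c /\ forall (P U : R -> M2) (eta : R), eta <= 1 ->
  (forall s, 0 <= s <= T -> continuous P s) ->
  (forall s, 0 <= s <= T -> norm (minus (P s) (P0 s)) <= eta) ->
  solves P T U ->
  forall s, 0 <= s <= T -> norm (minus (U s) (U0 s)) <= c * eta.
Proof.
intros HT HP0 [HU0 HU0d]. destruct (linear_ode_bound P0 T HT HP0) as [c [Hc0 Hc]].
assert (HU0c : forall s, 0 <= s <= T -> continuous U0 s).
{ intros s Hs. eapply Mderive_continuous. now apply HU0d. }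
destruct (norm_bounded U0 T HT HU0c) as [M [HM0 HM]].
exists (c * (8 * M)). split. apply Rmult_lt_0_compat; lra.
intros P U eta He HP HPP [HU HUd] s Hs.
replace (c * (8 * M) * eta) with (c * (8 * (eta * M))) by ring.
apply (Hc P (fun s => minus (U s) (U0 s)) (fun s => mmul (minus (P s) (P0 s)) (U0 s)));
  auto.
- intros r Hr. eapply Rle_trans. now apply HPP. easy.
- intros r Hr. apply continuous_mmul; auto.
  apply (continuous_minus (V := M2)); auto.
- intros r Hr. eapply Rle_trans. apply norm_mmul.
  apply Rmult_le_compat_l. lra. apply Rmult_le_compat; auto using norm_ge_0.
- rewrite HU, HU0. apply (minus_eq_zero (G := M2)).
- intros r Hr. evar_last. apply (is_derive_minus (V := M2)); auto.
  mring; ring.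
Qed.

Lemma tube_lemma (Pr : R -> R -> Prop) (a b t0 : R) :
  (forall s, a <= s <= b -> locally (s, t0) (fun p => Pr (fst p) (snd p))) ->
  locally t0 (fun t => forall s, a <= s <= b -> Pr s t).
Proof.
intros H.
assert (Hd : forall s, exists d : posreal, a <= s <= b ->
  forall r t, Rabs (r - s) < d -> Rabs (t - t0) < d -> Pr r t).
{ intros s. destruct (excluded_middle_informative (a <= s <= b)) as [Hs | Hs].
  - destruct (H s Hs) as [d Hd]. exists d. intros _ r t Hr Ht.
    apply (Hd (r, t)). now split.
  - exists (mkposreal 1 Rlt_0_1). now intros. }
apply ClassicalEpsilon.choice in Hd. destruct Hd as [d Hd].
destruct (compactness_value_1d a b d) as [e He].
exists e. intros t Ht s Hs. apply Classical_Prop.NNPP. intros Hn.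
apply (He s Hs). intros [r (Hr1 & Hr2 & Hr3)]. apply Hn.
apply (Hd r Hr1); [easy |]. eapply Rlt_le_trans. apply Ht. easy.
Qed.

Lemma is_derive_eps (f : R -> M2) (x : R) (l : M2) :
  (forall eps, 0 < eps -> locally x (fun y =>
     norm (minus (minus (f y) (f x)) (scal (y - x) l)) <= eps * Rabs (y - x))) ->
  is_Mderive f x l.
Proof.
intros H. split. apply (is_linear_scal_l (K := R_AbsRing)).
intros y Hy. apply (is_filter_lim_locally_unique (V := R_NormedModule)) in Hy. subst y.
intros eps. apply (H eps (cond_pos eps)).
Qed.

Lemma increment_estimate (f df : R -> M2) (l : M2) (x y eps : R) :
  (forall z, Rmin x y <= z <= Rmax x y -> is_Mderive f z (df z)) ->
  (forall z, Rmin x y <= z <= Rmax x y -> continuous df z) ->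
  (forall z, Rmin x y <= z <= Rmax x y -> norm (minus (df z) l) <= eps) ->
  norm (minus (minus (f y) (f x)) (scal (y - x) l)) <= eps * Rabs (y - x).
Proof.
assert (Hw : forall x y, x <= y ->
  (forall z, x <= z <= y -> is_Mderive f z (df z)) ->
  (forall z, x <= z <= y -> continuous df z) ->
  (forall z, x <= z <= y -> norm (minus (df z) l) <= eps) ->
  norm (minus (minus (f y) (f x)) (scal (y - x) l)) <= eps * (y - x)).
{ clear. intros x y Hxy Hd Hc Hb. rewrite Rmult_comm.
  apply (norm_RInt_le_const (V := M2) (fun z => minus (df z) l) x y); auto.
  apply (is_RInt_minus (V := M2)).
  - apply (is_RInt_derive (V := M2)); rewrite Rmin_left, Rmax_right by easy; auto.
  - apply (is_RInt_const (V := M2)). }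
destruct (Rle_dec x y) as [Hxy | Hxy].
- rewrite Rmin_left, Rmax_right, Rabs_right by lra. now apply Hw.
- rewrite Rmin_right, Rmax_left, Rabs_left by lra. intros Hd Hc Hb.
  replace (- (y - x)) with (x - y) by ring.
  replace (minus (minus (f y) (f x)) (scal (y - x) l)) with
    (opp (minus (minus (f x) (f y)) (scal (x - y) l))).
  rewrite (norm_opp (V := M2)). apply Hw; auto; lra.
  mring; rewrite !RtoC_minus; ring.
Qed.

(** * Derivative of the holonomy along a family of paths *)

Lemma continuous_slice_s {W : UniformSpace} (f : R -> R -> W) s t :
  continuous (fun p => f (fst p) (snd p)) (s, t) -> continuous (fun s => f s t) s.
Proof.
intros H. apply (continuous_comp (fun s => (s, t)) (fun p => f (fst p) (snd p))); [| easy].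
apply (continuous_pair (U := R_UniformSpace) (V := R_UniformSpace)).
apply continuous_id. apply continuous_const.
Qed.
Lemma continuous_slice_t {W : UniformSpace} (f : R -> R -> W) s t :
  continuous (fun p => f (fst p) (snd p)) (s, t) -> continuous (fun t => f s t) t.
Proof.
intros H. apply (continuous_comp (fun t => (s, t)) (fun p => f (fst p) (snd p))); [| easy].
apply (continuous_pair (U := R_UniformSpace) (V := R_UniformSpace)).
apply continuous_const. apply continuous_id.
Qed.

Lemma uniform_slices (f : R -> R -> M2) (T t0 eps : R) :
  0 < eps ->
  (forall s, 0 <= s <= T -> continuous (fun p => f (fst p) (snd p)) (s, t0)) ->
  locally t0 (fun t => forall s, 0 <= s <= T -> norm (minus (f s t) (f s t0)) <= eps).
Proof.
intros He Hf. apply (tube_lemma (fun s t => norm (minus (f s t) (f s t0)) <= eps)).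
intros s Hs. specialize (Hf s Hs).
assert (Hc : continuous (fun p => minus (f (fst p) (snd p)) (f (fst p) t0)) (s, t0)).
{ apply (continuous_minus (V := M2)); [easy |].
  apply (continuous_comp (fun p : R * R => fst p) (fun s => f s t0)).
  apply (continuous_fst (U := R_UniformSpace) (V := R_UniformSpace)).
  now apply continuous_slice_s. }
pose proof (proj1 (filterlim_locally_ball_norm (U := M2) _ _) Hc (mkposreal eps He)) as H.
generalize H. apply filter_imp. intros [r t]. unfold ball_norm; simpl. intros Hr.
replace (minus (f r t) (f r t0)) with
  (minus (minus (f r t) (f r t0)) (minus (f s t0) (f s t0))) by (mring; ring).
now apply Rlt_le.
Qed.

Lemma mmul_minus_l A B D : mmul (minus A B) D = minus (mmul A D) (mmul B D).
Proof. mring; ring. Qed.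
Lemma mmul_scal_l (r : R) A B : mmul (scal r A) B = scal r (mmul A B).
Proof. mring; ring. Qed.
Lemma mmul_scal_r (r : R) A B : mmul A (scal r B) = scal r (mmul A B).
Proof. mring; ring. Qed.
Lemma mmul_one_l A : mmul mone A = A.
Proof. mring; ring. Qed.
Lemma mmul_one_r A : mmul A mone = A.
Proof. mring; ring. Qed.
Lemma mmul_zero_l A : mmul zero A = zero.
Proof. mring; ring. Qed.
Lemma mmul_zero_r A : mmul A zero = zero.
Proof. mring; ring. Qed.

(** With [p0], [q], [pt] the values of [P], [Q] and [dP/dt = dQ/ds] at [(s, t0)] and
    [p] the value of [P] at [(s, t0 + h)], the defect
    [n (1 + h q0) - (1 + h q) w] solves the equation of [p] up to the forcing
    [((p - p0 - h pt) + h (p - p0) q) w], which is small compared with [h]. *)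
Lemma gauge_identity (p p0 pt q q0 n w : M2) (h : R) : mmul p0 q = mmul q p0 ->
  minus (plus (mmul (mmul p n) (plus mone (scal h q0))) (mmul n zero))
    (plus (mmul (plus zero (scal h pt)) w) (mmul (plus mone (scal h q)) (mmul p0 w))) =
  plus (mmul p (minus (mmul n (plus mone (scal h q0))) (mmul (plus mone (scal h q)) w)))
    (mmul (plus (minus (minus p p0) (scal h pt)) (scal h (mmul (minus p p0) q))) w).
Proof.
intros Hc.
repeat rewrite ?mmul_plus_l, ?mmul_plus_r, ?mmul_minus_l, ?mmul_minus_r, ?mmul_scal_l,
  ?mmul_scal_r, ?mmul_one_l, ?mmul_one_r, ?mmul_zero_l, ?mmul_zero_r.
rewrite (mmul_assoc q p0 w), <- Hc, !mmul_assoc.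
generalize (mmul p n) (mmul (mmul p n) q0) (mmul p w) (mmul (mmul p q) w)
  (mmul (mmul p0 q) w) (mmul p0 w) (mmul pt w).
intros. mring; ring.
Qed.

(** The derivative of the holonomy of a flat family.  Flatness is
    [dP/dt - dQ/ds + (P Q - Q P) = 0].  Here [P] and [Q] are the values of one sum of
    closed forms on two tangent vectors, so that [dP/dt = dQ/ds], and multiples of
    one matrix, so that they commute.  To first order in [h], the
    gauge transformation [1 + h Q] carries the equation at [t0] to the equation at
    [t0 + h], so the two holonomies differ by its values at the end points. *)
Lemma holonomy_derive (P Q Pt : R -> R -> M2) (U : R -> R -> M2) (T t0 : R) :
  0 <= T ->
  (forall s, 0 <= s <= T -> locally (s, t0) (fun p =>
     is_Mderive (fun t => P (fst p) t) (snd p) (Pt (fst p) (snd p)) /\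
     continuous (fun q => P (fst q) (snd q)) p /\
     continuous (fun q => Pt (fst q) (snd q)) p)) ->
  (forall s, 0 <= s <= T -> is_Mderive (fun s => Q s t0) s (Pt s t0)) ->
  (forall s, 0 <= s <= T -> mmul (P s t0) (Q s t0) = mmul (Q s t0) (P s t0)) ->
  locally t0 (fun t => solves (fun s => P s t) T (U t)) ->
  is_Mderive (fun t => U t T) t0
    (minus (mmul (Q T t0) (U t0 T)) (mmul (U t0 T) (Q 0 t0))).
Proof.
intros HT Hloc HQ Hcomm HU.
pose proof (tube_lemma (fun s t =>
     is_Mderive (fun t => P s t) t (Pt s t) /\
     continuous (fun q => P (fst q) (snd q)) (s, t) /\
     continuous (fun q => Pt (fst q) (snd q)) (s, t)) 0 T t0) as Hgood.
assert (Hgood' : locally t0 (fun t => forall s, 0 <= s <= T ->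
     is_Mderive (fun t => P s t) t (Pt s t) /\
     continuous (fun q => P (fst q) (snd q)) (s, t) /\
     continuous (fun q => Pt (fst q) (snd q)) (s, t))).
{ apply Hgood. intros s Hs. generalize (Hloc s Hs). apply filter_imp.
  now intros [r t]. }
clear Hgood Hloc. rename Hgood' into Hgood.
pose proof (locally_singleton _ _ Hgood) as Hgood0.
pose proof (locally_singleton _ _ HU) as HU0.
assert (HcP0 : forall s, 0 <= s <= T -> continuous (fun s => P s t0) s).
{ intros s Hs. apply continuous_slice_s. exact (proj1 (proj2 (Hgood0 s Hs))). }
assert (HcPt0 : forall s, 0 <= s <= T -> continuous (fun s => Pt s t0) s).
{ intros s Hs. apply continuous_slice_s. exact (proj2 (proj2 (Hgood0 s Hs))). }
assert (HcQ : forall s, 0 <= s <= T -> continuous (fun s => Q s t0) s).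
{ intros s Hs. eapply Mderive_continuous. now apply HQ. }
assert (HcU : forall s, 0 <= s <= T -> continuous (U t0) s).
{ intros s Hs. eapply Mderive_continuous. now apply HU0. }
destruct (norm_bounded _ T HT HcPt0) as [M1 [HM1 HPt]].
destruct (norm_bounded _ T HT HcQ) as [M2' [HM2 HQb]].
destruct (norm_bounded _ T HT HcU) as [M3 [HM3 HUb]].
destruct (linear_ode_bound _ T HT HcP0) as [c [Hc0 Hc]].
destruct (linear_ode_perturbation _ _ T HT HcP0 HU0) as [c' [Hc0' Hc']].
set (A := c * (8 * ((1 + 8 * M2') * M3)) + 8 * (c' * M2')).
assert (HA : 0 < A).
{ unfold A. assert (0 < (1 + 8 * M2') * M3) by (apply Rmult_lt_0_compat; lra).
  assert (0 < c' * M2') by (apply Rmult_lt_0_compat; lra).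
  assert (0 < c * (8 * ((1 + 8 * M2') * M3))) by (apply Rmult_lt_0_compat; lra). lra. }
apply is_derive_eps. intros eps He.
set (eta := Rmin 1 (eps / A)).
assert (Heta : 0 < eta).
{ apply Rmin_pos. lra. now apply Rdiv_lt_0_compat. }
assert (Heta1 : eta <= 1) by apply Rmin_l.
assert (HetaA : eta * A <= eps).
{ apply Rle_trans with (eps / A * A). apply Rmult_le_compat_r. lra. apply Rmin_r.
  right. field. lra. }
assert (Hunif := uniform_slices Pt T t0 eta Heta (fun s Hs => proj2 (proj2 (Hgood0 s Hs)))).
destruct (filter_and _ _ Hgood Hunif) as [d Hd].
assert (Hdel : 0 < eta / (1 + M1)) by (apply Rdiv_lt_0_compat; lra).
assert (Hsmall : locally t0 (fun t => Rabs (t - t0) < eta / (1 + M1))).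
{ exists (mkposreal _ Hdel). intros t Ht. apply Ht. }
assert (Hball : locally t0 (fun t => ball t0 d t)) by (exists d; auto).
generalize (filter_and _ _ (filter_and _ _ HU Hsmall) Hball). apply filter_imp.
intros t [[HUt Ht] Hbt].
set (h := t - t0) in *.
assert (Hseg : forall z, Rmin t0 t <= z <= Rmax t0 t -> ball t0 d z).
{ intros z Hz. change (Rabs (z - t0) < d). change (Rabs (t - t0) < d) in Hbt.
  revert Hz Hbt. unfold Rmin, Rmax. destruct (Rle_dec t0 t); intros Hz;
  unfold Rabs; repeat destruct Rcase_abs; lra. }
assert (HT1 : forall s, 0 <= s <= T ->
  norm (minus (minus (P s t) (P s t0)) (scal h (Pt s t0))) <= eta * Rabs h).
{ intros s Hs. apply (increment_estimate (fun t => P s t) (fun t => Pt s t)); intros z Hz;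
  destruct (Hd z (Hseg z Hz)) as [G1 G2]; destruct (G1 s Hs) as (G3 & G4 & G5).
  - exact G3.
  - now apply continuous_slice_t.
  - now apply G2. }
assert (HcP : forall s, 0 <= s <= T -> continuous (fun s => P s t) s).
{ intros s Hs. apply continuous_slice_s. destruct (Hd t Hbt) as [G _].
  exact (proj1 (proj2 (G s Hs))). }
assert (Hh : 0 <= Rabs h) by apply Rabs_pos.
assert (HPd : forall s, 0 <= s <= T -> norm (minus (P s t) (P s t0)) <= eta).
{ intros s Hs. 
  replace (minus (P s t) (P s t0)) with (plus (minus (minus (P s t) (P s t0)) (scal h (Pt s t0)))
    (scal h (Pt s t0))) by (mring; ring).
  eapply Rle_trans. apply (norm_triangle (V := M2)).
  eapply Rle_trans. apply Rplus_le_compat. now apply HT1.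
  apply (norm_scal (V := M2)).
  change (abs h) with (Rabs h).
  apply Rle_trans with (Rabs h * (1 + M1)).
  - generalize (HPt s Hs) (norm_ge_0 (Pt s t0)). nra.
  - apply Rlt_le in Ht. apply (Rmult_le_compat_r (1 + M1)) in Ht; [| lra].
    eapply Rle_trans. apply Ht. right. field. lra. }
set (D := fun s => minus (mmul (U t s) (plus mone (scal h (Q 0 t0))))
                         (mmul (plus mone (scal h (Q s t0))) (U t0 s))).
assert (HDT : norm (D T) <= c * (8 * (eta * Rabs h * (1 + 8 * M2') * M3))).
{ apply (Hc (fun s => P s t) D (fun s => mmul (plus (minus (minus (P s t) (P s t0)) (scal h (Pt s t0)))
     (scal h (mmul (minus (P s t) (P s t0)) (Q s t0)))) (U t0 s))); auto; try lra.
  - intros s Hs. eapply Rle_trans. now apply HPd. easy.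
  - intros s Hs. apply continuous_mmul; [| now apply HcU].
    apply (continuous_plus (V := M2)).
    + apply (continuous_minus (V := M2)). apply (continuous_minus (V := M2)); auto.
      apply (@continuous_scal_r R_UniformSpace R_AbsRing M2). auto.
    + apply (@continuous_scal_r R_UniformSpace R_AbsRing M2). apply continuous_mmul; auto.
      apply (continuous_minus (V := M2)); auto.
  - intros s Hs. eapply Rle_trans. apply norm_mmul.
    apply Rmult_le_compat_l; [lra |].
    apply Rmult_le_compat; try apply norm_ge_0; [| now apply HUb].
    eapply Rle_trans. apply (norm_triangle (V := M2)).
    rewrite Rmult_plus_distr_l, Rmult_1_r.
    apply Rplus_le_compat. now apply HT1.
    eapply Rle_trans. apply (norm_scal (V := M2)). change (abs h) with (Rabs h).
    rewrite (Rmult_comm eta), Rmult_assoc. apply Rmult_le_compat_l; [easy |].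
    eapply Rle_trans. apply norm_mmul.
    replace (eta * (8 * M2')) with (8 * (eta * M2')) by ring.
    apply Rmult_le_compat_l; [lra |]. apply Rmult_le_compat; auto using norm_ge_0.
  - unfold D. rewrite (proj1 HUt), (proj1 HU0), mmul_one_l, mmul_one_r.
    apply (minus_eq_zero (G := M2)).
  - intros s Hs. unfold D. evar_last.
    + apply (is_derive_minus (V := M2)); apply is_derive_mmul.
      now apply HUt. apply is_derive_const.
      apply (is_derive_plus (V := M2)). apply is_derive_const.
      apply (is_derive_linear (U := M2) (V := M2) (scal h)).
      apply (is_linear_scal_r (V := M2)). intros; apply Rmult_comm.
      now apply HQ. now apply HU0.
    + apply gauge_identity. now apply Hcomm. }
assert (HNU : norm (minus (U t T) (U t0 T)) <= c' * eta).
{ apply (Hc' (fun s => P s t) (U t)); auto. lra. }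
replace (minus (minus (U t T) (U t0 T))
  (scal h (minus (mmul (Q T t0) (U t0 T)) (mmul (U t0 T) (Q 0 t0))))) with
  (minus (D T) (scal h (mmul (minus (U t T) (U t0 T)) (Q 0 t0)))).
2: { unfold D. rewrite mmul_plus_l, mmul_plus_r, mmul_one_l, mmul_one_r, mmul_minus_l,
  mmul_scal_l, mmul_scal_r.
  generalize (mmul (U t T) (Q 0 t0)) (mmul (U t0 T) (Q 0 t0)) (mmul (Q T t0) (U t0 T)).
  intros. mring; ring. }
eapply Rle_trans. apply (norm_triangle (V := M2)). 
eapply Rle_trans. apply Rplus_le_compat. apply HDT.
rewrite (norm_opp (V := M2)). eapply Rle_trans. apply (norm_scal (V := M2)).
change (abs h) with (Rabs h). apply Rmult_le_compat_l. easy.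
eapply Rle_trans. apply norm_mmul. apply Rmult_le_compat_l. lra.
apply Rmult_le_compat. apply norm_ge_0. apply norm_ge_0. apply HNU. apply HQb. lra.
apply Rle_trans with ((eta * A) * Rabs h).
right. unfold A. ring. now apply Rmult_le_compat_r.
Qed.

(** * Fuchsian systems along families of paths *)

(** A Fuchsian system: the finite poles together with their residue matrices. *)
Definition poles := list (C * M2).

(** The value at the point [z], on the tangent vector [v], of the connection form
    [sum_p A_p dz / (z - p)]. *)
Fixpoint conn (l : poles) (z v : C) : M2 :=
  match l with
  | nil => zero
  | (p, A) :: l' => plus (mscal (v / (z - p)) A) (conn l' z v)
  end.

(** The derivative of [conn l z v] when [z] and [v] move with velocities [z'] and
    [v'].  It is symmetric in [v] and [z'], and this symmetry is the closedness of
    the forms [dz / (z - p)]. *)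
Fixpoint dconn (l : poles) (z v z' v' : C) : M2 :=
  match l with
  | nil => zero
  | (p, A) :: l' => plus (mscal (v' / (z - p) - v * z' / ((z - p) * (z - p))) A)
                         (dconn l' z v z' v')
  end.

Fixpoint regular (l : poles) (z : C) : Prop :=
  match l with nil => True | (p, _) :: l' => z <> p /\ regular l' z end.

Lemma dconn_sym l z v z' v' : dconn l z v z' v' = dconn l z z' v v'.
Proof.
induction l as [| [p A] l IH]; simpl; [easy |]. rewrite IH.
now rewrite (Cmult_comm v z').
Qed.

Lemma Cminus_neq_0 (z p : C) : z <> p -> (z - p <> 0)%C.
Proof.
intros H E. apply H. replace z with (z - p + p)%C by ring. rewrite E. ring.
Qed.

Lemma is_derive_Cconst (c : C) x : is_Cderive (fun _ => c) x (RtoC 0).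
Proof. exact (is_derive_const (V := C_R_NormedModule) c x). Qed.

Lemma is_derive_mscal_l (c : R -> C) (A : M2) x a :
  is_Cderive c x a -> is_Mderive (fun t => mscal (c t) A) x (mscal a A).
Proof.
intros Hc. apply is_derive_mat; (evar_last;
 [apply is_derive_Cmult; [apply Hc | apply is_derive_Cconst] |
  unfold mscal, mat, e11, e12, e21, e22; simpl; ring]).
Qed.

Lemma conn_derive l (f g : R -> C) (x : R) (f' g' : C) :
  regular l (f x) -> is_Cderive f x f' -> is_Cderive g x g' ->
  is_Mderive (fun x => conn l (f x) (g x)) x (dconn l (f x) (g x) f' g').
Proof.
intros Hr Hf Hg. induction l as [| [p A] l IH]; simpl.
- apply (is_derive_const (V := M2) zero).
- destruct Hr as [Hp Hr]. apply Cminus_neq_0 in Hp.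
  apply (is_derive_plus (V := M2)); [| now apply IH].
  apply is_derive_mscal_l. evar_last.
  + apply is_derive_Cmult. apply Hg.
    apply (is_derive_Cinv (fun x => f x - p)%C); [easy |].
    apply is_derive_Cminus. apply Hf. apply is_derive_Cconst.
  + cbv beta.  field. easy.
Qed.

Section Cont.
Context {T : UniformSpace}.
Lemma conn_continuous l (f g : T -> C) x :
  regular l (f x) -> continuous f x -> continuous g x ->
  continuous (fun x => conn l (f x) (g x)) x.
Proof.
intros Hr Hf Hg. induction l as [| [p A] l IH]; simpl.
- apply continuous_const.
- destruct Hr as [Hp Hr]. apply Cminus_neq_0 in Hp.
  apply (continuous_plus (V := M2)); [| now apply IH].
  apply continuous_mscal; [| apply continuous_const].
  apply continuous_Cmult; [easy |]. apply continuous_Cinv; [easy |].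
  apply continuous_Cminus; [easy | apply continuous_const].
Qed.
Lemma dconn_continuous l (f g f' g' : T -> C) x :
  regular l (f x) -> continuous f x -> continuous g x ->
  continuous f' x -> continuous g' x ->
  continuous (fun x => dconn l (f x) (g x) (f' x) (g' x)) x.
Proof.
intros Hr Hf Hg Hf' Hg'. induction l as [| [p A] l IH]; simpl.
- apply continuous_const.
- destruct Hr as [Hp Hr]. apply Cminus_neq_0 in Hp.
  assert (Hc : continuous (fun x => f x - p)%C x)
    by (apply continuous_Cminus; [easy | apply continuous_const]).
  apply (continuous_plus (V := M2)); [| now apply IH].
  apply continuous_mscal; [| apply continuous_const].
  apply continuous_Cminus; apply continuous_Cmult; try easy.
  + now apply continuous_Cinv.
  + now apply continuous_Cmult.
  + apply continuous_Cinv. now apply Cmult_neq_0. now apply continuous_Cmult.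
Qed.

Lemma regular_open l (f : T -> C) x :
  regular l (f x) -> continuous f x -> locally x (fun y => regular l (f y)).
Proof.
intros Hr Hf. induction l as [| [p A] l IH]; simpl.
- now apply filter_forall.
- destruct Hr as [Hp Hr]. apply filter_and; [| now apply IH].
  assert (Hc : continuous (fun y => f y - p)%C x)
    by (apply continuous_Cminus; [easy | apply continuous_const]).
  assert (Hn : continuous (fun y => fst (f y - p)%C * fst (f y - p)%C +
    snd (f y - p)%C * snd (f y - p)%C) x).
  { apply (continuous_plus (V := R_NormedModule)); apply (continuous_mult (K := R_AbsRing));
    auto using continuous_Re, continuous_Im. }
  assert (H0 : 0 < fst (f x - p)%C * fst (f x - p)%C + snd (f x - p)%C * snd (f x - p)%C).
  { apply Cminus_neq_0, Cnormsq_pos in Hp. simpl in Hp |- *. lra. }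
  generalize (Hn (fun r => 0 < r) (open_gt 0 _ H0)). unfold filtermap.
  apply filter_imp. intros y Hy E. rewrite E in Hy. simpl in Hy.
  rewrite !Rplus_opp_r in Hy. lra.
Qed.
End Cont.

(** All values of the form at one point are multiples of a single matrix, hence
    they commute. *)
Lemma conn_scal l z v : conn l z v = mscal v (conn l z 1).
Proof.
induction l as [| [p A] l IH]; simpl.
- mring; ring.
- rewrite IH. generalize (conn l z 1). intros N. unfold Cdiv.
  generalize (/ (z - p))%C. intros c. mring; ring.
Qed.

Lemma conn_comm l z v w : mmul (conn l z v) (conn l z w) = mmul (conn l z w) (conn l z v).
Proof.
rewrite (conn_scal l z v), (conn_scal l z w). generalize (conn l z 1). intros N.
mring; ring.
Qed.

Lemma conn_zero l z : conn l z 0 = zero.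
Proof. rewrite conn_scal. generalize (conn l z 1). intros N. mring; ring. Qed.

Record path_family (z zs zt zst : R -> R -> C) : Prop := {
  fam_s : forall s t, is_Cderive (fun s => z s t) s (zs s t);
  fam_t : forall s t, is_Cderive (fun t => z s t) t (zt s t);
  fam_st : forall s t, is_Cderive (fun t => zs s t) t (zst s t);
  fam_ts : forall s t, is_Cderive (fun s => zt s t) s (zst s t);
  fam_c : forall p, continuous (fun p : R * R => z (fst p) (snd p)) p;
  fam_cs : forall p, continuous (fun p : R * R => zs (fst p) (snd p)) p;
  fam_ct : forall p, continuous (fun p : R * R => zt (fst p) (snd p)) p;
  fam_cst : forall p, continuous (fun p : R * R => zst (fst p) (snd p)) p }.

Lemma Cderive_continuous (f : R -> C) x d : is_Cderive f x d -> continuous f x.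
Proof. intros H. apply (ex_derive_continuous (V := C_R_NormedModule)). now exists d. Qed.

Lemma family_prod (f f' g g' : R -> C) :
  (forall s, is_Cderive f s (f' s)) -> (forall s, continuous f' s) ->
  (forall t, is_Cderive g t (g' t)) -> (forall t, continuous g' t) ->
  path_family (fun s t => f s * g t)%C (fun s t => f' s * g t)%C
         (fun s t => f s * g' t)%C (fun s t => f' s * g' t)%C.
Proof.
intros Hf Hcf' Hg Hcg'.
assert (Hcf : forall s, continuous f s) by (intros s; eapply Cderive_continuous; apply Hf).
assert (Hcg : forall s, continuous g s) by (intros s; eapply Cderive_continuous; apply Hg).
assert (Hl : forall (h k : R -> C) x h', is_Cderive h x h' -> forall c,
  is_Cderive (fun s => h s * c)%C x (h' * c)%C).
{ intros h _ x h' Hh c. evar_last. apply is_derive_Cmult. apply Hh. apply is_derive_Cconst.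
  simpl. ring. }
assert (Hr : forall (h k : R -> C) x h', is_Cderive h x h' -> forall c,
  is_Cderive (fun s => c * h s)%C x (c * h')%C).
{ intros h _ x h' Hh c. evar_last. apply is_derive_Cmult. apply is_derive_Cconst. apply Hh.
  simpl. ring. }
assert (Hc : forall h k : R -> C, (forall s, continuous h s) -> (forall s, continuous k s) ->
  forall p, continuous (fun p : R * R => h (fst p) * k (snd p))%C p).
{ intros h k Hh Hk [s t]. apply continuous_Cmult.
  - apply (continuous_comp (fun p : R * R => fst p) h); [| apply Hh].
    apply (continuous_fst (U := R_UniformSpace) (V := R_UniformSpace)).
  - apply (continuous_comp (fun p : R * R => snd p) k); [| apply Hk].
    apply (continuous_snd (U := R_UniformSpace) (V := R_UniformSpace)). }
split; auto.
Qed.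

Lemma family_plus (z zs zt zst w ws wt wst : R -> R -> C) :
  path_family z zs zt zst -> path_family w ws wt wst ->
  path_family (fun s t => z s t + w s t)%C (fun s t => zs s t + ws s t)%C
         (fun s t => zt s t + wt s t)%C (fun s t => zst s t + wst s t)%C.
Proof.
intros [] []; split; intros; first [apply is_derive_Cplus | apply continuous_Cplus]; auto.
Qed.

Section Family.
Context (l : poles) (z zs zt zst : R -> R -> C) (Hz : path_family z zs zt zst).
Context (T : R) (HT : 0 <= T).
Let P s t := conn l (z s t) (zs s t).
Definition regular_slice t := forall s, 0 <= s <= T -> regular l (z s t).

Lemma conn_slice_continuous t : regular_slice t ->
  forall s, 0 <= s <= T -> continuous (fun s => P s t) s.
Proof.
intros H s Hs. apply conn_continuous. now apply H.
eapply Cderive_continuous. apply (fam_s _ _ _ _ Hz).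
apply (continuous_slice_s zs). apply (fam_cs _ _ _ _ Hz).
Qed.

Lemma regular_slice_open t : regular_slice t -> locally t regular_slice.
Proof.
intros H. apply (tube_lemma (fun s t => regular l (z s t))).
intros s Hs. apply (regular_open l (fun p : R * R => z (fst p) (snd p))).
now apply H. apply (fam_c _ _ _ _ Hz).
Qed.

Lemma slice_solutions_exist : exists U : R -> R -> M2,
  forall t, regular_slice t -> solves (fun s => P s t) T (U t).
Proof.
apply (ClassicalEpsilon.choice (fun t U => regular_slice t -> solves (fun s => P s t) T U)).
intros t. destruct (excluded_middle_informative (regular_slice t)) as [H | H].
- destruct (linear_ode_exists (fun s => P s t) T HT) as [V HV].
  now apply conn_slice_continuous. now exists V.
- now exists (fun _ => zero).
Qed.

Context (U : R -> R -> M2)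
  (HU : forall t, regular_slice t -> solves (fun s => P s t) T (U t)).

Lemma family_holonomy_derive t0 : regular_slice t0 ->
  is_Mderive (fun t => U t T) t0
    (minus (mmul (conn l (z T t0) (zt T t0)) (U t0 T))
           (mmul (U t0 T) (conn l (z 0 t0) (zt 0 t0)))).
Proof.
intros H.
apply (holonomy_derive P (fun s t => conn l (z s t) (zt s t))
  (fun s t => dconn l (z s t) (zs s t) (zt s t) (zst s t))).
- easy.
- intros s Hs.
  generalize (regular_open l (fun p : R * R => z (fst p) (snd p)) (s, t0) (H s Hs)
    (fam_c _ _ _ _ Hz (s, t0))).
  apply filter_imp. intros [r t] Hr. simpl in *. split; [| split].
  + apply conn_derive. easy. apply (fam_t _ _ _ _ Hz). apply (fam_st _ _ _ _ Hz).
  + apply (conn_continuous l (fun p : R * R => z (fst p) (snd p))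
      (fun p : R * R => zs (fst p) (snd p))); [easy | apply (fam_c _ _ _ _ Hz)
        | apply (fam_cs _ _ _ _ Hz)].
  + apply (dconn_continuous l (fun p : R * R => z (fst p) (snd p))
      (fun p : R * R => zs (fst p) (snd p)) (fun p : R * R => zt (fst p) (snd p))
      (fun p : R * R => zst (fst p) (snd p))); [easy | apply (fam_c _ _ _ _ Hz)
        | apply (fam_cs _ _ _ _ Hz) | apply (fam_ct _ _ _ _ Hz) | apply (fam_cst _ _ _ _ Hz)].
- intros s Hs. rewrite dconn_sym.
  apply (conn_derive l (fun s => z s t0) (fun s => zt s t0)). now apply H.
  apply (fam_s _ _ _ _ Hz). apply (fam_ts _ _ _ _ Hz).
- intros s Hs. apply conn_comm.
- generalize (regular_slice_open t0 H). apply filter_imp. exact HU.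
Qed.

Lemma mtr_derive (f : R -> M2) x d : is_Mderive f x d ->
  is_Cderive (fun t => mtr (f t)) x (mtr d).
Proof.
intros H. apply is_derive_entries in H. now apply is_derive_Cplus.
Qed.

Lemma mtr_comm A B : mtr (mmul A B) = mtr (mmul B A).
Proof. unfold mtr, mmul, mat, e11, e12, e21, e22; simpl. ring. Qed.

(** Along a family of closed paths the derivative of the holonomy [G] is a
    commutator [Q G - G Q]. *)
Lemma closed_family_trace (a b : R) :
  a < b -> (forall t, a <= t <= b -> regular_slice t) ->
  (forall t, z 0 t = z T t) -> (forall t, zt 0 t = zt T t) ->
  mtr (U a T) = mtr (U b T).
Proof.
intros Hab Hr H1 H2.
apply (eq_is_derive (V := C_R_NormedModule) (fun t => mtr (U t T))); [| easy].
intros t Ht. evar_last. apply mtr_derive. apply family_holonomy_derive. now apply Hr.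
rewrite H1, H2. unfold minus. rewrite mplus_mat, mopp_mat.
change (@zero C_R_NormedModule) with (RtoC 0).
generalize (mtr_comm (conn l (z T t) (zt T t)) (U t T)).
generalize (mmul (conn l (z T t) (zt T t)) (U t T))
  (mmul (U t T) (conn l (z T t) (zt T t))). intros X Y.
destruct X as [[x1 x2] [x3 x4]], Y as [[y1 y2] [y3 y4]].
unfold mtr, mat, e11, e12, e21, e22; simpl. intros E.
transitivity (x1 + x4 - (y1 + y4))%C; [ring |]. rewrite E. ring.
Qed.
End Family.

(** * Holonomy around a circle that shrinks to a pole *)

Definition cexp (z : C) : C := (exp (fst z) * cos (snd z), exp (fst z) * sin (snd z)).

Lemma cexp_0 : cexp 0 = 1.
Proof. unfold cexp; simpl. rewrite exp_0, cos_0, sin_0. apply injective_projections; simpl; ring. Qed.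

Lemma cexp_plus z w : cexp (z + w) = (cexp z * cexp w)%C.
Proof.
destruct z as [a b], w as [c d]. unfold cexp; simpl. rewrite exp_plus, cos_plus, sin_plus.
apply injective_projections; simpl; ring.
Qed.

Lemma cexp_derive (c : C) s : is_Cderive (fun s => cexp (c * RtoC s)) s (c * cexp (c * RtoC s))%C.
Proof.
destruct c as [a b]. apply is_derive_C; unfold cexp; simpl.
- auto_derive; [easy | unfold Rminus; ring].
- auto_derive; [easy | unfold Rminus; ring].
Qed.

Definition eis (s : R) : C := (cos s, sin s).

Lemma eis_derive s : is_Cderive eis s (Ci * eis s)%C.
Proof. apply is_derive_C; unfold eis; simpl; (auto_derive; [easy | ring]). Qed.

Lemma eis_sqr s : cos s ^ 2 + sin s ^ 2 = 1.
Proof. generalize (sin2_cos2 s). unfold Rsqr. lra. Qed.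

Lemma mtr_plus (A B : M2) : mtr (plus A B) = (mtr A + mtr B)%C.
Proof.
destruct A as [[a b] [c d]], B as [[a' b'] [c' d']]. rewrite mplus_mat.
unfold mtr, mat, e11, e22; simpl. ring.
Qed.
Lemma mtr_mscal c (A : M2) : mtr (mscal c A) = (c * mtr A)%C.
Proof. destruct A as [[a b] [e d]]. unfold mtr, mscal, mat, e11, e22; simpl. ring. Qed.
Lemma mtr_mone : mtr mone = RtoC 2.
Proof. apply injective_projections; simpl; ring. Qed.

(** The solution is [exp (i s A)], which by [A^2 = lam^2] equals
    [cos (lam s) + i A sin (lam s) / lam], and [1 + i s A] when [lam = 0]. *)
Lemma constant_ode (A : M2) (lam : C) (T : R) :
  mtr A = 0 -> mmul A A = mscal (lam * lam) mone ->
  exists U, solves (fun _ => mscal Ci A) T U /\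
    forall s, mtr (U s) = (cexp (Ci * lam * RtoC s) + cexp (- (Ci * lam) * RtoC s))%C.
Proof.
intros Ht HA. destruct (excluded_middle_informative (lam = 0)) as [H0 | H0].
- exists (fun s => plus mone (mscal (Ci * RtoC s) A)). split; [split |].
  + mring; ring.
  + intros s _.
    assert (HA0 : mmul A A = zero).
    { rewrite HA, H0. mring; ring. }
    replace (mmul (mscal Ci A) (plus mone (mscal (Ci * RtoC s) A))) with (plus zero (mscal Ci A)).
    * apply (is_derive_plus (V := M2)). apply (is_derive_const (V := M2) mone).
      apply is_derive_mscal_l. apply is_derive_C; simpl; (auto_derive; [easy | ring]).
    * transitivity (plus (mscal Ci A) (mscal (Ci * Ci * RtoC s) (mmul A A))).
      rewrite HA0. mring; ring. mring; ring.
  + intros s. rewrite H0.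
    replace (Ci * 0 * RtoC s)%C with (RtoC 0) by ring.
    replace (- (Ci * 0) * RtoC s)%C with (RtoC 0) by ring.
    rewrite cexp_0, mtr_plus, mtr_mscal, mtr_mone, Ht.
    apply injective_projections; simpl; ring.
- set (E := fun s => cexp (Ci * lam * RtoC s)). set (F := fun s => cexp (- (Ci * lam) * RtoC s)).
  exists (fun s => plus (mscal ((E s + F s) / 2) mone) (mscal ((E s - F s) / (2 * lam)) A)).
  assert (HE : forall s, is_Cderive E s (Ci * lam * E s)%C) by (intros; apply cexp_derive).
  assert (HF : forall s, is_Cderive F s (- (Ci * lam) * F s)%C) by (intros; apply cexp_derive).
  assert (H2 : (RtoC 2 <> 0)%C) by (intros H; apply RtoC_inj in H; lra).
  assert (Hi : forall c : C, forall f s d, is_Cderive f s d -> is_Cderive (fun s => f s / c)%C s (d / c)%C).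
  { intros c f s d Hf. evar_last. apply is_derive_Cmult. apply Hf. apply is_derive_Cconst.
    cbv beta. unfold Cdiv. ring. }
  split; [split |].
  + unfold E, F. rewrite !Cmult_0_r, cexp_0.
    transitivity (plus (mscal 1 mone) (mscal 0 A)). 2: { mring; ring. }
    f_equal; f_equal; field; easy.
  + intros s _.
    replace (mmul (mscal Ci A) _) with
      (plus (mscal ((Ci * lam * E s + - (Ci * lam) * F s) / 2) mone)
            (mscal ((Ci * lam * E s - - (Ci * lam) * F s) / (2 * lam)) A)).
    * apply (is_derive_plus (V := M2)); apply is_derive_mscal_l; apply Hi.
      now apply is_derive_Cplus. now apply is_derive_Cminus.
    * generalize (E s) (F s). intros e f.
      transitivity (plus (mscal (Ci * ((e + f) / 2)) A)
                     (mscal (Ci * ((e - f) / (2 * lam))) (mmul A A))).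
      2: { generalize ((e + f) / 2)%C ((e - f) / (2 * lam))%C. intros x y. mring; ring. }
      rewrite HA.
      replace (mscal (Ci * ((e - f) / (2 * lam))) (mscal (lam * lam) mone)) with
        (mscal ((Ci * lam * e + - (Ci * lam) * f) / 2) mone).
      2: { transitivity (mscal ((Ci * ((e - f) / (2 * lam))) * (lam * lam)) mone).
           f_equal. field; auto. mring; ring. }
      replace ((Ci * lam * e - - (Ci * lam) * f) / (2 * lam))%C with (Ci * ((e + f) / 2))%C
        by (field; auto).
      apply (plus_comm (G := M2)).
  + intros s. fold (E s). fold (F s).
    rewrite mtr_plus, !mtr_mscal, mtr_mone, Ht. field; auto.
Qed.

(** The circle symmetric about the real direction with diameter
    [p - mu t, p + mu t + 2 kap t^2].  The quadratic term lets a family of circles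
    that is centred at [p] to first order reach a circle with another centre.  Sums
    of products of functions of one variable make a family smooth at no cost
    ([family_prod], [family_plus]). *)
Definition circ (p : C) (kap mu s t : R) : C :=
  (RtoC 1 * (p + RtoC (kap * t ^ 2)) + eis s * RtoC (mu * t + kap * t ^ 2))%C.
Definition circ_s (p : C) (kap mu s t : R) : C :=
  (RtoC 0 * (p + RtoC (kap * t ^ 2)) + Ci * eis s * RtoC (mu * t + kap * t ^ 2))%C.
Definition circ_t (kap mu s t : R) : C :=
  (RtoC 1 * RtoC (2 * kap * t) + eis s * RtoC (mu + 2 * kap * t))%C.
Definition circ_st (kap mu s t : R) : C :=
  (RtoC 0 * RtoC (2 * kap * t) + Ci * eis s * RtoC (mu + 2 * kap * t))%C.

Lemma eis_continuous s : continuous eis s.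
Proof. eapply Cderive_continuous. apply eis_derive. Qed.

Lemma Ceis_continuous s : continuous (fun s => Ci * eis s)%C s.
Proof. apply continuous_Cmult. apply continuous_const. apply eis_continuous. Qed.

Lemma RtoC_continuous (f : R -> R) s : ex_derive f s -> continuous (fun s => RtoC (f s)) s.
Proof.
intros H. apply continuous_C; simpl. now apply (ex_derive_continuous (V := R_NormedModule)).
apply continuous_const.
Qed.

Lemma circ_family p kap mu :
  path_family (circ p kap mu) (circ_s p kap mu) (circ_t kap mu) (circ_st kap mu).
Proof.
unfold circ, circ_s, circ_t, circ_st.
apply family_plus.
- apply (family_prod (fun _ => RtoC 1) (fun _ => RtoC 0) (fun t => p + RtoC (kap * t ^ 2))%C
    (fun t => RtoC (2 * kap * t))).
  + intros s. apply is_derive_Cconst.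
  + intros s. apply continuous_const.
  + intros t. apply is_derive_C; simpl; (auto_derive; [easy | ring]).
  + intros t. apply RtoC_continuous. auto_derive. easy.
- apply (family_prod eis (fun s => Ci * eis s)%C (fun t => RtoC (mu * t + kap * t ^ 2))%C
    (fun t => RtoC (mu + 2 * kap * t))).
  + intros s. apply eis_derive.
  + intros s. apply Ceis_continuous.
  + intros t. apply is_derive_C; simpl; (auto_derive; [easy | ring]).
  + intros t. apply RtoC_continuous. auto_derive. easy.
Qed.

(** The circle blown up at [p]: [circ = p + t circ_w].  The logarithmic derivative
    [circ_ws / circ_w] remains defined at [t = 0], where it is the constant [i]. *)
Definition circ_w (kap mu s t : R) : C := (RtoC (kap * t) + RtoC (mu + kap * t) * eis s)%C.
Definition circ_ws (kap mu s t : R) : C := (RtoC (mu + kap * t) * (Ci * eis s))%C.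

(** A zero would give [|kap t| = mu + kap t]. *)
Lemma circ_w_neq_0 kap mu s t : 0 < mu -> 0 <= kap -> 0 <= t -> circ_w kap mu s t <> 0.
Proof.
intros Hm Hk Ht E. apply (f_equal fst) in E as E1. apply (f_equal snd) in E.
simpl in E, E1. generalize (eis_sqr s). intros H.
assert (0 <= kap * t) by now apply Rmult_le_pos.
assert ((mu + kap * t) ^ 2 = (kap * t) ^ 2).
{ replace ((mu + kap * t) ^ 2) with ((mu + kap * t) ^ 2 * (cos s ^ 2 + sin s ^ 2))
    by (rewrite H; ring).
  replace ((mu + kap * t) ^ 2 * (cos s ^ 2 + sin s ^ 2)) with
    (((mu + kap * t) * cos s) ^ 2 + ((mu + kap * t) * sin s) ^ 2) by ring.
  replace ((mu + kap * t) * cos s) with (- (kap * t)) by lra.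
  replace ((mu + kap * t) * sin s) with 0 by lra. ring. }
nra.
Qed.

Lemma circ_eq p kap mu s t : circ p kap mu s t = (p + RtoC t * circ_w kap mu s t)%C.
Proof. apply injective_projections; simpl; ring. Qed.
Lemma circ_s_eq p kap mu s t : circ_s p kap mu s t = (RtoC t * circ_ws kap mu s t)%C.
Proof. apply injective_projections; simpl; ring. Qed.

Lemma circ_neq_centre p kap mu s t :
  0 < mu -> 0 <= kap -> 0 < t -> circ p kap mu s t <> p.
Proof.
intros Hm Hk Ht E. rewrite circ_eq in E.
assert (E' : (RtoC t * circ_w kap mu s t)%C = 0).
{ replace (RtoC t * circ_w kap mu s t)%C with (p + RtoC t * circ_w kap mu s t - p)%C by ring.
  rewrite E. ring. }
apply Cmult_neq_0 in E'; [easy | |].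
- intros F. apply RtoC_inj in F. lra.
- apply circ_w_neq_0; lra.
Qed.

Lemma mtr_norm (A B : M2) : Cmod (mtr A - mtr B) <= 2 * norm (minus A B).
Proof.
replace (mtr A - mtr B)%C with (e11 (minus A B) + e22 (minus A B))%C.
- eapply Rle_trans. apply Cmod_triangle.
  generalize (Cmod_e11 (minus A B)) (Cmod_e22 (minus A B)). lra.
- destruct A as [[a b] [c d]], B as [[a' b'] [c' d']].
  unfold minus. rewrite mplus_mat, mopp_mat.
  unfold mtr, mat, e11, e22; simpl. ring.
Qed.

(** The trace of the holonomy around a pole is [2 cos (2 pi lam)], where [lam] and
    [- lam] are the eigenvalues of the residue.  The trace does not depend on [t],
    and as [t] tends to 0 the equation on the circle tends, uniformly, to the
    equation with the constant coefficient [i A]. *)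
Lemma shrinking_circle_trace (p : C) (A : M2) (l : poles) (kap mu : R) (lam : C) (U1 : R -> M2) :
  0 < mu -> 0 <= kap -> mtr A = 0 -> mmul A A = mscal (lam * lam) mone ->
  regular l p ->
  (forall s t, 0 < t <= 1 -> regular l (circ p kap mu s t)) ->
  solves (fun s => conn ((p, A) :: l) (circ p kap mu s 1) (circ_s p kap mu s 1)) (2 * PI) U1 ->
  mtr (U1 (2 * PI)) =
    (cexp (Ci * lam * RtoC (2 * PI)) + cexp (- (Ci * lam) * RtoC (2 * PI)))%C.
Proof.
intros Hm Hk Ht HA Hp Hl HU1.
assert (HT : 0 <= 2 * PI) by (generalize PI_RGT_0; lra).
destruct (constant_ode A lam (2 * PI) Ht HA) as [U0 [HU0 HU0t]].
rewrite <- HU0t.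
set (z := circ p kap mu). set (zs := circ_s p kap mu).
assert (Hreg : forall t, 0 < t <= 1 -> regular_slice ((p, A) :: l) z (2 * PI) t).
{ intros t Ht1 s _. split; [| now apply Hl]. now apply circ_neq_centre. }
destruct (slice_solutions_exist ((p, A) :: l) _ _ _ _ (circ_family p kap mu) (2 * PI) HT)
  as [U HU].
assert (HU1' : U1 (2 * PI) = U 1 (2 * PI)).
{ assert (H1 : 0 < 1 <= 1) by lra.
  apply (linear_ode_unique (fun s => conn ((p, A) :: l) (z s 1) (zs s 1)) (2 * PI)).
  - apply (conn_slice_continuous _ _ _ _ _ (circ_family p kap mu)). now apply Hreg.
  - apply HU1.
  - apply HU. now apply Hreg.
  - rewrite (proj1 HU1). symmetry. apply HU. now apply Hreg.
  - lra. }
rewrite HU1'.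
assert (Hconst : forall t, 0 < t <= 1 -> mtr (U t (2 * PI)) = mtr (U 1 (2 * PI))).
{ intros t Ht1. destruct (Rle_lt_or_eq_dec t 1 (proj2 Ht1)) as [H1 | ->]; [| easy].
  apply (closed_family_trace _ _ _ _ _ (circ_family p kap mu) (2 * PI) HT U HU); try easy.
  - intros r Hr. apply Hreg. lra.
  - intros r. unfold z, circ, eis. now rewrite cos_2PI, sin_2PI, cos_0, sin_0.
  - intros r. unfold circ_t, eis. now rewrite cos_2PI, sin_2PI, cos_0, sin_0. }
(* The form pulled back to the circles, extended continuously to t = 0. *)
set (P := fun s t => plus (mscal (circ_ws kap mu s t / circ_w kap mu s t) A)
                          (conn l (z s t) (RtoC t * circ_ws kap mu s t))).
assert (HP0 : forall s, P s 0 = mscal Ci A).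
{ intros s. unfold P. rewrite Cmult_0_l, conn_zero.
  replace (circ_ws kap mu s 0 / circ_w kap mu s 0)%C with Ci. mring; ring.
  assert (Hw := circ_w_neq_0 kap mu s 0 Hm Hk (Rle_refl 0)).
  replace (circ_ws kap mu s 0) with (Ci * circ_w kap mu s 0)%C. field. easy.
  unfold circ_ws, circ_w. apply injective_projections; simpl; ring. }
assert (HPt : forall s t, 0 < t -> P s t = conn ((p, A) :: l) (z s t) (zs s t)).
{ intros s t Ht1. simpl. unfold P, z, zs. rewrite circ_s_eq. f_equal. f_equal.
  rewrite circ_eq.
  assert (Hw := circ_w_neq_0 kap mu s t Hm Hk (Rlt_le _ _ Ht1)).
  assert (RtoC t <> 0) by (intros F; apply RtoC_inj in F; lra).
  replace (p + RtoC t * circ_w kap mu s t - p)%C with (RtoC t * circ_w kap mu s t)%C by ring.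
  field; auto. }
assert (Hcw : forall q, continuous (fun q : R * R => circ_w kap mu (fst q) (snd q)) q /\
  continuous (fun q : R * R => circ_ws kap mu (fst q) (snd q)) q).
{ intros [s t].
  assert (H1 : forall f : R -> R, ex_derive f t ->
    continuous (fun q : R * R => RtoC (f (snd q))) (s, t)).
  { intros f Hf. apply (continuous_comp (fun q : R * R => snd q) (fun t => RtoC (f t))).
    apply (continuous_snd (U := R_UniformSpace) (V := R_UniformSpace)).
    now apply RtoC_continuous. }
  assert (H2 : continuous (fun q : R * R => eis (fst q)) (s, t)).
  { apply (continuous_comp (fun q : R * R => fst q) eis).
    apply (continuous_fst (U := R_UniformSpace) (V := R_UniformSpace)).
    apply eis_continuous. }
  split.
  - apply continuous_Cplus; [| apply continuous_Cmult; [| easy]];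
    [apply (H1 (fun t => kap * t)) | apply (H1 (fun t => mu + kap * t))]; auto_derive; easy.
  - apply continuous_Cmult. apply (H1 (fun t => mu + kap * t)). auto_derive; easy.
    apply continuous_Cmult. apply continuous_const. easy. }
assert (HcP : forall s, 0 <= s <= 2 * PI -> continuous (fun q => P (fst q) (snd q)) (s, 0)).
{ intros s _. destruct (Hcw (s, 0)) as [C1 C2].
  apply (continuous_plus (V := M2)).
  - apply continuous_mscal; [| apply continuous_const].
    apply continuous_Cmult. easy. apply continuous_Cinv; [| easy].
    apply circ_w_neq_0; simpl; lra.
  - apply (conn_continuous l (fun q : R * R => z (fst q) (snd q))).
    + simpl. unfold z. rewrite circ_eq, Cmult_0_l, Cplus_0_r. easy.
    + apply (fam_c _ _ _ _ (circ_family p kap mu)).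
    + apply continuous_Cmult; [| easy].
      apply (continuous_comp (fun q : R * R => snd q) (fun t => RtoC t)).
      apply (continuous_snd (U := R_UniformSpace) (V := R_UniformSpace)).
      apply (RtoC_continuous (fun t => t)). auto_derive. easy. }
destruct (linear_ode_perturbation (fun _ => mscal Ci A) U0 (2 * PI) HT) as [c [Hc0 Hc]].
{ intros s _. apply continuous_const. }
{ exact HU0. }
assert (Hmod : Cmod (mtr (U 1 (2 * PI)) - mtr (U0 (2 * PI))) <= 0).
{ apply le_epsilon. intros eps He.
  set (eta := Rmin 1 (eps / (2 * c))).
  assert (Heta : 0 < eta) by (apply Rmin_pos; [lra | apply Rdiv_lt_0_compat; lra]).
  destruct (uniform_slices P (2 * PI) 0 eta Heta HcP) as [d Hd].
  set (t := Rmin 1 (d / 2)).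
  assert (Ht0 : 0 < t) by (apply Rmin_pos; generalize (cond_pos d); lra).
  assert (Ht1 : t <= 1) by apply Rmin_l.
  assert (Hbt : ball 0 d t).
  { change (Rabs (t - 0) < d). rewrite Rminus_0_r, Rabs_right by lra.
    eapply Rle_lt_trans. apply Rmin_r. generalize (cond_pos d); lra. }
  rewrite <- (Hconst t) by lra.
  eapply Rle_trans. apply mtr_norm.
  assert (Hn : norm (minus (U t (2 * PI)) (U0 (2 * PI))) <= c * eta).
  { apply (Hc (fun s => conn ((p, A) :: l) (z s t) (zs s t)) (U t)).
    - apply Rmin_l.
    - apply (conn_slice_continuous _ _ _ _ _ (circ_family p kap mu)). now apply Hreg.
    - intros s Hs. rewrite <- HPt, <- (HP0 s) by easy. now apply (Hd t).
    - apply HU. now apply Hreg.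
    - lra. }
  rewrite Rplus_0_l. apply Rle_trans with (2 * (c * (eps / (2 * c)))).
  - apply Rmult_le_compat_l; [lra |]. eapply Rle_trans. apply Hn.
    apply Rmult_le_compat_l; [lra |]. apply Rmin_r.
  - right. field. lra. }
revert Hmod. generalize (mtr (U 1 (2 * PI))) (mtr (U0 (2 * PI))). intros x y Hmod.
assert (E : (x - y)%C = 0).
{ apply Cmod_eq_0, Rle_antisym. easy. apply Cmod_ge_0. }
replace x with (x - y + y)%C by ring. rewrite E. ring.
Qed.

(** * A family of arcs that crosses a pole *)

Lemma mmul_adj_r A : mmul A (madj A) = mscal (mdet A) mone.
Proof. unfold mdet. mring; ring. Qed.
Lemma mmul_adj_l A : mmul (madj A) A = mscal (mdet A) mone.
Proof. unfold mdet. mring; ring. Qed.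
Lemma mtr_adj A : mtr (madj A) = mtr A.
Proof. destruct A as [[a b] [c d]]. unfold mtr, madj, mat, e11, e22; simpl. ring. Qed.
Lemma mscal_one A : mscal 1 A = A.
Proof. mring; ring. Qed.
Lemma mmul_mscal_r c A B : mmul A (mscal c B) = mscal c (mmul A B).
Proof. mring; ring. Qed.
Lemma mdet_solution (P U : R -> M2) (T : R) :
  (forall s, mtr (P s) = 0) -> solves P T U ->
  forall s, 0 <= s <= T -> mdet (U s) = 1.
Proof.
intros HP [HU0 HU] s Hs.
replace (RtoC 1) with (mdet (U 0)).
2: { rewrite HU0. unfold mdet, mone, mat, e11, e12, e21, e22; simpl. ring. }
destruct (Rle_lt_or_eq_dec 0 s (proj1 Hs)) as [H | <-]; [| easy].
symmetry. apply (eq_is_derive (V := C_R_NormedModule) (fun s => mdet (U s))); [| easy].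
intros t Ht. evar_last.
- destruct (is_derive_entries _ _ _ (HU t ltac:(lra))) as (H1 & H2 & H3 & H4).
  apply is_derive_Cminus; apply is_derive_Cmult; eassumption.
- change (@zero C_R_NormedModule) with (RtoC 0).
  transitivity (mtr (P t) * mdet (U t))%C. 2: { rewrite HP. ring. }
  destruct (P t) as [[a b] [c d]], (U t) as [[a' b'] [c' d']].
  unfold mdet, mtr, mmul, mat, e11, e12, e21, e22; simpl. ring.
Qed.

Fixpoint traceless (l : poles) : Prop :=
  match l with nil => True | (_, A) :: l' => mtr A = 0 /\ traceless l' end.

Lemma conn_traceless l z v : traceless l -> mtr (conn l z v) = 0.
Proof.
induction l as [| [p A] l IH]; simpl.
- intros _. rewrite mzero_mat. unfold mtr, mat, e11, e22; simpl. ring.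
- intros [HA Hl]. rewrite mtr_plus, mtr_mscal, HA, IH by easy. ring.
Qed.

Lemma conn_opp l z v : conn l z (- v) = opp (conn l z v).
Proof.
rewrite (conn_scal l z (- v)), (conn_scal l z v). generalize (conn l z 1). intros N.
mring; ring.
Qed.

Lemma conn_swap x y l z v : conn (x :: y :: l) z v = conn (y :: x :: l) z v.
Proof.
destruct x as [p A], y as [q B]. simpl.
generalize (conn l z v) (mscal (v / (z - p)) A) (mscal (v / (z - q)) B).
intros N X Y. mring; ring.
Qed.

Lemma solves_ext (P Q U : R -> M2) T :
  (forall s, P s = Q s) -> solves P T U -> solves Q T U.
Proof. intros H [H0 H1]. split; [easy |]. intros s Hs. rewrite <- H. now apply H1. Qed.

Section Joining.
Context (m n : R) (Hn : 0 < n) (Hmn : n < m).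

(** For [t] in [0, pi], the arc [s |-> join s t], [0 <= s <= 2 pi], leads from the
    point [m + n e^{it}] of the circle [loop] counterclockwise around 0 to the
    conjugate point.  For [t = 0] it is the circle of radius [m + n] about 0, and for
    [t = pi] the circle of radius [m - n] about 0.  The term in [cos (s / 2)] moves
    the end points off the real axis. *)
Definition join (s t : R) : C :=
  (eis s * RtoC (m + n * cos t) + Ci * RtoC (cos (s / 2)) * RtoC (n * sin t))%C.
Definition join_s (s t : R) : C :=
  (Ci * eis s * RtoC (m + n * cos t) + Ci * RtoC (- (/ 2 * sin (s / 2))) * RtoC (n * sin t))%C.
Definition join_t (s t : R) : C :=
  (eis s * RtoC (- (n * sin t)) + Ci * RtoC (cos (s / 2)) * RtoC (n * cos t))%C.
Definition join_st (s t : R) : C :=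
  (Ci * eis s * RtoC (- (n * sin t)) + Ci * RtoC (- (/ 2 * sin (s / 2))) * RtoC (n * cos t))%C.

Lemma join_family : path_family join join_s join_t join_st.
Proof.
unfold join, join_s, join_t, join_st. apply family_plus.
- apply (family_prod eis (fun s => Ci * eis s)%C (fun t => RtoC (m + n * cos t))
    (fun t => RtoC (- (n * sin t)))).
  + apply eis_derive.
  + apply Ceis_continuous.
  + intros t. apply is_derive_C; simpl; (auto_derive; [easy | ring]).
  + intros t. apply RtoC_continuous. auto_derive. easy.
- apply (family_prod (fun s => Ci * RtoC (cos (s / 2)))%C
   (fun s => Ci * RtoC (- (/ 2 * sin (s / 2))))%C (fun t => RtoC (n * sin t))
    (fun t => RtoC (n * cos t))).
  + intros s. apply is_derive_C; simpl; (auto_derive; [easy | unfold Rdiv; ring]).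
  + intros s. apply continuous_Cmult. apply continuous_const.
    apply RtoC_continuous. auto_derive. easy.
  + intros t. apply is_derive_C; simpl; (auto_derive; [easy | ring]).
  + intros t. apply RtoC_continuous. auto_derive. easy.
Qed.

(** The imaginary part is [cos (s / 2) * (2 X sin (s / 2) + Y)] with [X > 0] and
    [Y >= 0].  The first factor vanishes at the negative point [- X], the second one
    only at the end points of the two circles. *)
Lemma join_avoids s t : 0 <= s <= 2 * PI -> 0 <= t <= PI -> snd (join s t) = 0 ->
  fst (join s t) < 0 \/ fst (join s t) = m + n \/ fst (join s t) = m - n.
Proof.
intros Hs Ht. set (r := s / 2). assert (Es : s = 2 * r) by (unfold r; field).
assert (E1 : fst (join s t) = (m + n * cos t) * cos s) by (simpl; ring).
assert (E2 : snd (join s t) = cos r * (2 * (m + n * cos t) * sin r + n * sin t)).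
{ simpl. fold r. rewrite Es, sin_2a. ring. }
rewrite E1, E2. intros H.
assert (Hr : 0 <= sin r) by (apply sin_ge_0; lra).
assert (Hst : 0 <= sin t) by (apply sin_ge_0; lra).
assert (HX : 0 < m + n * cos t) by (generalize (COS_bound t); nra).
generalize (eis_sqr r) (eis_sqr t). intros Hr2 Ht2.
rewrite Es, cos_2a.
apply Rmult_integral in H. destruct H as [H | H].
- left. rewrite H. assert (sin r * sin r = 1) by (rewrite H in Hr2; lra). nra.
- right. assert (H1 : sin r = 0) by nra. assert (H2 : sin t = 0) by nra.
  rewrite H1 in *. rewrite H2 in Ht2.
  replace (cos r * cos r - 0 * 0) with 1 by lra.
  assert (H3 : (cos t - 1) * (cos t + 1) = 0) by lra.
  apply Rmult_integral in H3. destruct H3 as [H3 | H3]; [left | right].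
  + replace (cos t) with 1 by lra. ring.
  + replace (cos t) with (-1) by lra. ring.
Qed.

Definition loop (t : R) : C := (RtoC m + RtoC n * eis t)%C.
Definition loop' (t : R) : C := (RtoC n * (Ci * eis t))%C.

(** The circle of radius [m + n] about 0 is freely homotopic to the product of [loop]
    and a conjugate of the circle of radius [m - n].  In terms of holonomies: let
    [G t] be the holonomy of the arc [join _ t], and [E t] that of the part of [loop]
    from its rightmost point to the starting point of the arc.  Both [G t * E t] and
    [E (2 pi - t)] solve the equation along the end points of the arcs, so they
    differ by a constant right factor; it is read off at [t = 0] and used at
    [t = pi]. *)
Lemma join_trace (l : poles) (c : C) (G0 G1 E : R -> M2) :
  (forall s t, 0 <= s <= 2 * PI -> 0 <= t <= PI -> regular l (join s t)) ->
  traceless l ->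
  solves (fun s => conn l (join s 0) (join_s s 0)) (2 * PI) G0 ->
  solves (fun s => conn l (join s PI) (join_s s PI)) (2 * PI) G1 ->
  solves (fun s => conn l (loop s) (loop' s)) (2 * PI) E ->
  G0 (2 * PI) = mscal c mone ->
  mtr (G1 (2 * PI)) = (c * mtr (E (2 * PI)%R))%C.
Proof.
intros Hreg Htr HG0 HG1 HE Hc.
assert (Hpi := PI_RGT_0).
assert (HT : 0 <= 2 * PI) by lra.
assert (Hsl : forall t, 0 <= t <= PI -> regular_slice l join (2 * PI) t).
{ intros t Ht s Hs. now apply Hreg. }
destruct (slice_solutions_exist l _ _ _ _ join_family (2 * PI) HT) as [U HU].
assert (HUG : forall t G, 0 <= t <= PI ->
  solves (fun s => conn l (join s t) (join_s s t)) (2 * PI) G ->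
  U t (2 * PI) = G (2 * PI)).
{ intros t G Ht HG. 
  apply (linear_ode_unique (fun s => conn l (join s t) (join_s s t)) (2 * PI)).
  - apply (conn_slice_continuous _ _ _ _ _ join_family). now apply Hsl.
  - apply HU. now apply Hsl.
  - apply HG.
  - rewrite (proj1 HG). apply HU. now apply Hsl.
  - lra. }
assert (Ez0 : forall t, join 0 t = loop t).
{ intros t. unfold join, loop, eis. unfold Rdiv. rewrite Rmult_0_l, cos_0, sin_0.
  apply injective_projections; simpl; ring. }
assert (Ez0' : forall t, join_t 0 t = loop' t).
{ intros t. unfold join_t, loop', eis. unfold Rdiv. rewrite Rmult_0_l, cos_0, sin_0.
  apply injective_projections; simpl; ring. }
assert (Ecs : forall t, cos (2 * PI - t) = cos t /\ sin (2 * PI - t) = - sin t).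
{ intros t. rewrite cos_minus, sin_minus, cos_2PI, sin_2PI. split; ring. }
assert (Ez1 : forall t, join (2 * PI) t = loop (2 * PI - t)).
{ intros t. destruct (Ecs t) as [E1 E2]. unfold join, loop, eis.
  replace (2 * PI / 2) with PI by field. rewrite E1, E2, cos_2PI, sin_2PI, cos_PI.
  apply injective_projections; simpl; ring. }
assert (Ez1' : forall t, join_t (2 * PI) t = (- loop' (2 * PI - t))%C).
{ intros t. destruct (Ecs t) as [E1 E2]. unfold join_t, loop', eis.
  replace (2 * PI / 2) with PI by field. rewrite E1, E2, cos_2PI, sin_2PI, cos_PI.
  apply injective_projections; simpl; ring. }
assert (HdetE : forall s, 0 <= s <= 2 * PI -> mdet (E s) = 1).
{ apply (mdet_solution _ _ _ (fun s => conn_traceless l _ _ Htr) HE). }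
set (K := mscal c (madj (E (2 * PI)))).
assert (HXY : mmul (U PI (2 * PI)) (E PI) = mmul (E (2 * PI - PI)) K).
{ apply (linear_ode_unique (fun t => conn l (join (2 * PI) t) (join_t (2 * PI) t)) PI
    (fun t => mmul (U t (2 * PI)) (E t)) (fun t => mmul (E (2 * PI - t)) K)).
  - intros t Ht. apply (conn_continuous l (fun t => join (2 * PI) t)).
    + apply Hreg; lra.
    + eapply Cderive_continuous. apply (fam_t _ _ _ _ join_family).
    + apply (continuous_comp (fun t => (2 * PI, t)) (fun p => join_t (fst p) (snd p))).
      apply (continuous_pair (U := R_UniformSpace) (V := R_UniformSpace)).
      apply continuous_const. apply continuous_id.
      apply (fam_ct _ _ _ _ join_family).
  - intros t Ht. evar_last.
    + apply is_derive_mmul.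
      apply (family_holonomy_derive l _ _ _ _ join_family (2 * PI) HT U HU). now apply Hsl.
      apply HE. lra.
    + rewrite Ez0, Ez0', mmul_minus_l, !mmul_assoc.
      generalize (mmul (mmul (conn l (join (2 * PI) t) (join_t (2 * PI) t)) (U t (2 * PI))) (E t)).
      generalize (mmul (mmul (U t (2 * PI)) (conn l (loop t) (loop' t))) (E t)).
      intros X Y. mring; ring.
  - intros t Ht. rewrite Ez1, Ez1', conn_opp.
    assert (H21 : is_derive (fun t => 2 * PI - t) t (- (1))).
    { auto_derive; [easy | ring]. }
    evar_last.
    + apply is_derive_mmul; [| apply (is_derive_const (V := M2) K)].
      apply (is_derive_comp (V := M2) E (fun t => 2 * PI - t)).
      apply HE. lra. apply H21.
    + rewrite mmul_zero_r.
      generalize (conn l (loop (2 * PI - t)) (loop' (2 * PI - t))) (E (2 * PI - t)).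
      intros X Y. 
      transitivity (opp (mmul (mmul X Y) K)).
      generalize (mmul X Y). intros Z. mring; rewrite RtoC_opp; ring.
      rewrite <- mmul_assoc. generalize (mmul Y K). intros Z. mring; ring.
  - rewrite (HUG 0 G0) by (easy || lra). rewrite Hc, (proj1 HE), mmul_one_r.
    rewrite Rminus_0_r. unfold K. rewrite mmul_mscal_r, mmul_adj_r, HdetE by lra.
    now rewrite mscal_one.
  - lra. }
replace (2 * PI - PI) with PI in HXY by ring.
rewrite (HUG PI G1) in HXY by (easy || lra).
assert (H1 : G1 (2 * PI) = mmul (mmul (E PI) K) (madj (E PI))).
{ rewrite <- HXY, <- mmul_assoc, mmul_adj_r, HdetE by lra.
  now rewrite mscal_one, mmul_one_r. }
rewrite H1, mtr_comm, mmul_assoc, mmul_adj_l, HdetE by lra.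
rewrite mscal_one, mmul_one_l. unfold K. now rewrite mtr_mscal, mtr_adj.
Qed.
End Joining.

(** * Complex exponentials and the real holonomy *)

Lemma Csqrt_exists (z : C) : exists w : C, (w * w)%C = z.
Proof.
destruct z as [x y]. set (r := sqrt (x ^ 2 + y ^ 2)).
assert (Hr : r * r = x ^ 2 + y ^ 2) by (apply sqrt_sqrt; nra).
assert (Hr0 : 0 <= r) by apply sqrt_pos.
assert (H1 : 0 <= (r + x) / 2) by nra.
assert (H2 : 0 <= (r - x) / 2) by nra.
set (u := sqrt ((r + x) / 2)). set (v := sqrt ((r - x) / 2)).
assert (Hu : u * u = (r + x) / 2) by now apply sqrt_sqrt.
assert (Hv : v * v = (r - x) / 2) by now apply sqrt_sqrt.
assert (Hu0 : 0 <= u) by apply sqrt_pos. assert (Hv0 : 0 <= v) by apply sqrt_pos.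
assert (Huv : (2 * u * v) * (2 * u * v) = y * y).
{ transitivity (4 * (u * u) * (v * v)); [ring |]. rewrite Hu, Hv. nra. }
destruct (Rle_lt_dec 0 y) as [Hy | Hy].
- exists (u, v). assert (2 * u * v = y).
  { assert (0 <= 2 * u * v) by (apply Rmult_le_pos; lra). nra. }
  apply injective_projections; simpl; lra.
- exists (u, - v). assert (2 * u * v = - y).
  { assert (0 <= 2 * u * v) by (apply Rmult_le_pos; lra). nra. }
  apply injective_projections; simpl; lra.
Qed.

Lemma eis_2PI_Z (x : R) (k : Z) : eis (x + 2 * PI * IZR k) = eis x.
Proof.
assert (Hn : forall (y : R) (n : nat), eis (y + 2 * PI * INR n) = eis y).
{ intros y n. replace (y + 2 * PI * INR n) with (y + 2 * INR n * PI) by ring.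
  unfold eis. now rewrite cos_period, sin_period. }
destruct (Z_le_gt_dec 0 k) as [Hk | Hk].
- rewrite <- (Z2Nat.id k), <- INR_IZR_INZ by easy. apply Hn.
- rewrite <- (Hn _ (Z.to_nat (- k))). f_equal.
  rewrite INR_IZR_INZ, Z2Nat.id by lia. rewrite opp_IZR. ring.
Qed.

Lemma cexp_eq_1 (z : C) : cexp z = 1 -> exists k : Z, z = (0, 2 * PI * IZR k).
Proof.
destruct z as [x y]. unfold cexp; simpl. intros H.
injection H as H1 H2. generalize (exp_pos x) (eis_sqr y). intros Hx Hy.
assert (Hs : sin y = 0) by (apply Rmult_integral in H2; destruct H2; [lra | easy]).
assert (Hc : cos y = 1).
{ rewrite Hs in Hy. assert (H3 : (cos y - 1) * (cos y + 1) = 0) by lra.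
  apply Rmult_integral in H3. destruct H3; [lra |]. nra. }
rewrite Hc, Rmult_1_r in H1.
assert (x = 0) by (apply exp_inv; now rewrite exp_0).
destruct (sin_eq_0_0 (y / 2)) as [k Hk].
{ assert (E : cos y = 1 - 2 * sin (y / 2) * sin (y / 2)).
  { replace y with (2 * (y / 2)) at 1 by field. apply cos_2a_sin. }
  rewrite Hc in E. nra. }
exists k. apply injective_projections; simpl; lra.
Qed.

(** The hypothesis is [cos (2 pi lam) = c cos (2 pi mu)] with [c = 1] or [c = -1], so
    [lam] is [mu] or [- mu] up to a half integer; squaring removes the sign. *)
Lemma cosine_equation (lam mu c : C) :
  (c * c)%C = 1 ->
  (cexp (Ci * lam * RtoC (2 * PI)) + cexp (- (Ci * lam) * RtoC (2 * PI)))%C =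
  (c * (cexp (Ci * mu * RtoC (2 * PI)) + cexp (- (Ci * mu) * RtoC (2 * PI))))%C ->
  exists k : Z, (4 * (mu * mu))%C = ((2 * lam - RtoC (IZR k)) * (2 * lam - RtoC (IZR k)))%C.
Proof.
intros Hc H.
set (X := cexp (Ci * lam * RtoC (2 * PI))) in *.
set (X' := cexp (- (Ci * lam) * RtoC (2 * PI))) in *.
set (Y := cexp (Ci * mu * RtoC (2 * PI))) in *.
set (Y' := cexp (- (Ci * mu) * RtoC (2 * PI))) in *.
assert (HX : (X * X')%C = 1).
{ unfold X, X'. rewrite <- cexp_plus, <- cexp_0. f_equal. ring. }
assert (HY : (Y * Y')%C = 1).
{ unfold Y, Y'. rewrite <- cexp_plus, <- cexp_0. f_equal. ring. }
assert (Hp : ((X - c * Y) * (X - c * Y'))%C = 0).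
{ transitivity (X * X - c * (Y + Y') * X + (c * c) * (Y * Y'))%C; [ring |].
  rewrite <- H, Hc, HY. transitivity (1 - X * X')%C; [ring |]. rewrite HX. ring. }
assert (Hcase : (X - c * Y)%C = 0 \/ (X - c * Y')%C = 0).
{ destruct (excluded_middle_informative ((X - c * Y)%C = 0)); [now left |].
  destruct (excluded_middle_informative ((X - c * Y')%C = 0)); [now right |].
  exfalso. revert Hp. now apply Cmult_neq_0. }
assert (Hw : forall w, cexp (Ci * w * RtoC (2 * PI)) = c ->
  exists k : Z, (2 * w)%C = RtoC (IZR k)).
{ intros w Hw. assert (H2 : cexp (Ci * w * RtoC (2 * PI) + Ci * w * RtoC (2 * PI)) = 1).
  { now rewrite cexp_plus, Hw. }
  apply cexp_eq_1 in H2. destruct H2 as [k Hk]. exists k.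
  destruct w as [u v]. generalize PI_RGT_0. intros Hpi.
  apply (f_equal fst) in Hk as H3. apply (f_equal snd) in Hk as H4. simpl in H3, H4.
  apply injective_projections; simpl; nra. }
assert (Hdiv : forall x y, (x * y)%C = 1 -> forall W, (X - c * x)%C = 0 -> (X * y)%C = W -> W = c).
{ intros x y Hxy W H1 <-. replace X with (X - c * x + c * x)%C by ring. rewrite H1.
  transitivity (c * (x * y))%C; [ring |]. rewrite Hxy. ring. }
destruct Hcase as [H1 | H1].
- destruct (Hw (lam - mu)%C) as [k Hk].
  { apply (Hdiv Y Y' HY); [easy |]. unfold X, Y'. rewrite <- cexp_plus. f_equal. ring. }
  exists k. replace (RtoC (IZR k)) with (2 * (lam - mu))%C. ring.
- destruct (Hw (lam + mu)%C) as [k Hk].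
  { apply (Hdiv Y' Y); [now rewrite Cmult_comm | easy |].
    unfold X, Y. rewrite <- cexp_plus. f_equal. ring. }
  exists k. replace (RtoC (IZR k)) with (2 * (lam + mu))%C. ring.
Qed.

(** If [(p, q)] solves the linear system with this matrix, then [z = p / q] solves
    [z' = i (g (z^2 + 1) / 2 + h z)].  On the unit circle [z = e^{i theta}] this is
    [theta' = g cos theta + h]. *)
Definition riccati (h g : C) : M2 := mscal (Ci / 2) (mat h g (- g) (- h)).

(** The holonomy maps the vector [(e^{ix}, 1)] to a multiple of
    [(e^{i theta(2 pi)}, 1) = (e^{ix}, 1)], for every [x].  Three of these eigenvectors
    already force a 2 x 2 matrix to be scalar, and its determinant is 1. *)
Lemma riccati_holonomy_scalar (g h : R -> R) (U : R -> M2) :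
  (forall s, continuous g s) -> (forall s, continuous h s) ->
  solves (fun s => riccati (RtoC (h s)) (RtoC (g s))) (2 * PI) U ->
  (forall x, 0 <= x < 2 * PI -> exists theta : R -> R,
     (forall s, is_derive theta s (g s * cos (theta s) + h s)) /\
     theta 0 = x /\ exists k : Z, theta (2 * PI) = x + 2 * PI * IZR k) ->
  exists c : C, (c * c)%C = 1 /\ U (2 * PI) = mscal c mone.
Proof.
intros Hg Hh HU Hth. assert (Hpi := PI_RGT_0).
assert (Hline : forall x, 0 <= x < 2 * PI ->
  (e11 (U (2 * PI)%R) * eis x + e12 (U (2 * PI)%R) -
   eis x * (e21 (U (2 * PI)%R) * eis x + e22 (U (2 * PI)%R)))%C = 0).
{ intros x Hx. destruct (Hth x Hx) as (th & Hd & H0 & k & Hk).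
  set (E := fun s => (e11 (U s) * eis x + e12 (U s) -
    eis (th s) * (e21 (U s) * eis x + e22 (U s)))%C).
  (* E measures the defect p - e^{i theta} q; it solves the scalar equation E' = a E. *)
  set (a := fun s => (Ci / 2 * (RtoC (h s) + RtoC (g s) * eis (th s)))%C).
  assert (Hac : forall s, continuous a s).
  { intros s. apply continuous_Cmult. apply continuous_const.
    assert (Hr : forall f : R -> R, (forall s, continuous f s) ->
      continuous (fun s => RtoC (f s)) s).
    { intros f Hf. apply continuous_C; simpl. apply Hf. apply continuous_const. }
    apply continuous_Cplus. now apply Hr. apply continuous_Cmult. now apply Hr.
    apply (continuous_comp th eis).
    apply (ex_derive_continuous (V := R_NormedModule)). eexists; apply Hd.
    apply eis_continuous. }
  destruct (bounded_on_segment (fun s => Cmod (a s)) 0 (2 * PI)) as [M [HM0 HM]].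
  { lra. }
  { intros s _. apply (continuous_ext (fun s => norm (a s : CR))). intros; apply norm_CR.
    apply (continuous_comp a (fun z : CR => norm z)). apply Hac. apply (filterlim_norm (V := CR)). }
  assert (HE : forall s, 0 <= s <= 2 * PI -> is_Cderive E s (a s * E s)%C).
  { intros s Hs. destruct (is_derive_entries _ _ _ (proj2 HU s Hs)) as (D1 & D2 & D3 & D4).
    assert (Deis : is_Cderive (fun s => eis (th s)) s
       (RtoC (g s * cos (th s) + h s) * (Ci * eis (th s)))%C).
    { evar_last. apply (is_derive_comp (V := C_R_NormedModule) eis th). apply eis_derive.
      apply Hd. apply injective_projections; simpl; unfold scal; simpl; unfold mult; simpl; ring. }
    evar_last.
    - unfold E. apply is_derive_Cminus.
      + apply is_derive_Cplus. apply is_derive_Cmult. apply D1. apply is_derive_Cconst. apply D2.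
      + apply is_derive_Cmult. apply Deis. apply is_derive_Cplus.
        apply is_derive_Cmult. apply D3. apply is_derive_Cconst. apply D4.
    - assert (Hcs : (eis (th s) * RtoC (cos (th s)))%C = ((eis (th s) * eis (th s) + 1) / 2)%C).
      { generalize (eis_sqr (th s)). unfold eis. generalize (cos (th s)) (sin (th s)).
        intros c d Hcd. assert (c * c = (c * c - d * d + 1) / 2) by lra.
        apply injective_projections; simpl; field_simplify; try lra. }
      unfold a, E, riccati.
      rewrite RtoC_plus, RtoC_mult.
      replace ((RtoC (g s) * RtoC (cos (th s)) + RtoC (h s)) * (Ci * eis (th s)))%C with
        (Ci * (RtoC (g s) * (eis (th s) * RtoC (cos (th s))) + RtoC (h s) * eis (th s)))%C by ring.
      rewrite Hcs. generalize (eis (th s)) (RtoC (g s)) (RtoC (h s)) (eis x).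
      destruct (U s) as [[u11 u12] [u21 u22]]. intros z G H w.
      unfold mmul, mscal, mat, e11, e12, e21, e22; simpl.
      field. }
  assert (HEz : E (2 * PI) = 0).
  { apply (ode_unique (V := CR) (fun s X => a s * X)%C (2 * PI) M E (fun _ => RtoC 0)).
    - intros s X Y Hs. rewrite !norm_CR.
      change (Cmod (a s * X - a s * Y) <= M * Cmod (X - Y)).
      replace (a s * X - a s * Y)%C with (a s * (X - Y))%C by ring.
      rewrite Cmod_mult. apply Rmult_le_compat_r. apply Cmod_ge_0. now apply HM.
    - intros s Hs. now apply HE.
    - intros s Hs. rewrite Cmult_0_r. apply is_derive_Cconst.
    - intros s Hs. apply continuous_Cmult. apply Hac. eapply Cderive_continuous. now apply HE.
    - intros s Hs. apply continuous_Cmult. apply Hac. apply continuous_const.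
    - unfold E. rewrite (proj1 HU), H0. unfold mone, mat, e11, e12, e21, e22; simpl. ring.
    - lra. }
  unfold E in HEz. now rewrite Hk, eis_2PI_Z in HEz. }
assert (Hdet : mdet (U (2 * PI)) = 1).
{ apply (mdet_solution (fun s => riccati (RtoC (h s)) (RtoC (g s))) U (2 * PI)); try easy; [| lra].
  intros s. unfold riccati. rewrite mtr_mscal. unfold mtr, mat, e11, e22; simpl. ring. }
generalize (Hline 0 ltac:(lra)) (Hline PI ltac:(lra)) (Hline (PI / 2) ltac:(lra)).
revert Hdet. generalize (U (2 * PI)). intros [[u11 u12] [u21 u22]].
unfold mdet, e11, e12, e21, e22, eis; simpl.
rewrite cos_0, sin_0, cos_PI, sin_PI, cos_PI2, sin_PI2.
intros Hdet H1 H2 H3.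
destruct u11 as [a1 b1], u12 as [a2 b2], u21 as [a3 b3], u22 as [a4 b4].
injection H1; injection H2; injection H3; intros.
assert (a2 = 0) by lra. assert (b2 = 0) by lra. assert (a3 = 0) by lra. assert (b3 = 0) by lra.
assert (a4 = a1) by lra. assert (b4 = b1) by lra. subst.
exists (a1, b1). split.
- rewrite <- Hdet. apply injective_projections; simpl; ring.
- mring; apply injective_projections; simpl; ring.
Qed.

Lemma cos_lipschitz x y : Rabs (cos x - cos y) <= Rabs (x - y).
Proof.
rewrite <- (Rmult_1_l (Rabs (x - y))).
apply (bounded_variation cos (fun t => - sin t) 1 y x).
intros t _. split. auto_derive; [easy | ring].
rewrite Rabs_Ropp. generalize (SIN_bound t). intros. now apply Rabs_le.
Qed.

Section Torus.
Context (omega delta A B D : R) (Ho : omega <> 0) (Hd : 0 < delta < 1).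
Definition gain (tau : R) : R := / (omega * (1 - delta * cos tau)).
Definition drift (tau : R) : R := (B + A * sin tau) * gain tau + D.

Lemma denominator_lower_bound tau : 1 - delta <= 1 - delta * cos tau.
Proof. generalize (COS_bound tau). nra. Qed.

Lemma denominator_neq_0 tau : omega * (1 - delta * cos tau) <> 0.
Proof. apply Rmult_integral_contrapositive_currified. easy. generalize (denominator_lower_bound tau). lra. Qed.

Lemma gain_continuous tau : continuous gain tau.
Proof.
apply (ex_derive_continuous (V := R_NormedModule)). unfold gain. auto_derive.
apply denominator_neq_0.
Qed.
Lemma drift_continuous tau : continuous drift tau.
Proof.
apply (ex_derive_continuous (V := R_NormedModule)). unfold drift, gain. auto_derive.
apply denominator_neq_0.
Qed.

Lemma torus_rhs_eq theta tau :
  torus_rhs omega delta A B D theta tau = gain tau * cos theta + drift tau.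
Proof. unfold torus_rhs, drift, gain. field. split; [generalize (denominator_lower_bound tau); lra | easy]. Qed.

Lemma torus_solution_exists x :
  exists theta, is_solution (torus_rhs omega delta A B D) theta /\ theta 0 = x.
Proof.
destruct (picard_lindelof (V := R_CompleteNormedModule)
  (fun tau theta => gain tau * cos theta + drift tau) (/ (Rabs omega * (1 - delta))) x)
  as [u [H0 Hu]].
- apply Rinv_0_lt_compat, Rmult_lt_0_compat; [now apply Rabs_pos_lt | lra].
- intros s a b. change (Rabs (gain s * cos a + drift s - (gain s * cos b + drift s)) <=
   / (Rabs omega * (1 - delta)) * Rabs (a - b)).
  replace (gain s * cos a + drift s - (gain s * cos b + drift s)) with
    (gain s * (cos a - cos b)) by ring.
  rewrite Rabs_mult. apply Rmult_le_compat; try apply Rabs_pos; [| apply cos_lipschitz].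
  unfold gain. rewrite Rabs_inv. apply Rinv_le_contravar.
  apply Rmult_lt_0_compat; [now apply Rabs_pos_lt | lra].
  rewrite Rabs_mult. apply Rmult_le_compat_l. apply Rabs_pos.
  generalize (denominator_lower_bound s) (Rle_abs (1 - delta * cos s)). lra.
- intros u Hu s. apply (continuous_plus (V := R_NormedModule)); [| apply drift_continuous].
  apply (continuous_mult (K := R_AbsRing)). apply gain_continuous.
  apply (continuous_comp u cos). apply Hu. apply continuous_cos.
- exists u. split; [| easy]. intros tau. rewrite torus_rhs_eq. apply Hu.
Qed.

Lemma poincare_identity_lift :
  poincare_is_identity (torus_rhs omega delta A B D) ->
  forall x, 0 <= x < 2 * PI -> exists theta : R -> R,
     (forall s, is_derive theta s (gain s * cos (theta s) + drift s)) /\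
     theta 0 = x /\ exists k : Z, theta (2 * PI) = x + 2 * PI * IZR k.
Proof.
intros Hp x Hx. assert (Hpi := PI_RGT_0).
specialize (Hp (exist _ x Hx)). unfold poincare_map in Hp. simpl in Hp.
set (f := torus_rhs omega delta A B D) in *.
assert (Hs : is_solution f (flow f x) /\ flow f x 0 = x).
{ unfold flow. apply epsilon_spec. apply torus_solution_exists. }
exists (flow f x). destruct Hs as [Hs H0]. split; [| split; [easy |]].
- intros s. rewrite <- torus_rhs_eq. apply Hs.
- exists (Int_part (flow f x (2 * PI) / (2 * PI))).
  apply (f_equal (@proj1_sig _ _)) in Hp. simpl in Hp. unfold frac_part in Hp.
  rewrite <- Hp at 2. field. lra.
Qed.
End Torus.

(** * The Fuchsian system of the torus equation *)

Lemma RtoC_neq_0 (x : R) : x <> 0 -> RtoC x <> 0.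
Proof. intros H E. apply H. now apply RtoC_inj. Qed.

Lemma riccati_square h g :
  mmul (riccati h g) (riccati h g) = mscal (- (h * h - g * g) / 4) mone.
Proof.
assert (E : (- (h * h - g * g) / 4)%C = (Ci / 2 * (Ci / 2) * (h * h - g * g))%C).
{ replace (Ci / 2 * (Ci / 2))%C with (RtoC (- / 4))
    by (apply injective_projections; simpl; field).
  rewrite RtoC_opp, RtoC_inv by lra. unfold Cdiv. ring. }
rewrite E. unfold riccati. generalize (Ci / 2)%C. intros c. mring; ring.
Qed.

Lemma riccati_traceless h g : mtr (riccati h g) = 0.
Proof. unfold riccati. rewrite mtr_mscal. unfold mtr, mat, e11, e22; simpl. ring. Qed.

(** With [zeta = e^{i tau}] and [delta = 2 a / (1 + a^2)], the denominator
    [1 - delta cos tau] vanishes exactly at [zeta = a] and [zeta = 1 / a], of which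
    only [a] lies in the unit disc. *)
Section Monodromy.
Context (omega a A B D : R) (Ho : omega <> 0) (Ha : 0 < a < 1).

(** The residue at [a] of the form [gain d tau]; the residue at [1 / a] is the
    opposite one, and there is none at 0. *)
Definition gain_residue : C := (- Ci * RtoC ((1 + a ^ 2) / (omega * (1 - a ^ 2))))%C.
(** The form [A sin tau gain d tau] is [A / (omega delta)] times the logarithmic
    differential of [1 - delta cos tau], which is a constant multiple of
    [(zeta - a) (zeta - 1 / a) / zeta]. *)
Definition sine_residue : C := RtoC (A * (1 + a ^ 2) / (2 * omega * a)).

Definition torus_poles : poles :=
  (RtoC 0, riccati (- (Ci * RtoC D) - sine_residue) 0) ::
  (RtoC a, riccati (RtoC B * gain_residue + sine_residue) gain_residue) ::
  (RtoC (/ a), riccati (- (RtoC B * gain_residue) + sine_residue) (- gain_residue)) :: nil.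

Let delta := 2 * a / (1 + a ^ 2).

Lemma delta_bounds : 0 < delta < 1.
Proof.
unfold delta. split. apply Rdiv_lt_0_compat; nra.
apply Rmult_lt_reg_r with (1 + a ^ 2). nra. field_simplify; nra.
Qed.

Lemma eis_regular s : regular torus_poles (eis s).
Proof.
generalize (eis_sqr s). intros H.
assert (Hr : forall r, 0 <= r -> r <> 1 -> eis s <> RtoC r).
{ intros r Hr0 Hr1 E. unfold eis in E. injection E as E1 E2. rewrite E1, E2 in H.
  apply Hr1. assert (E3 : (r - 1) * (r + 1) = 0) by lra.
  apply Rmult_integral in E3. destruct E3; lra. }
assert (H1 : 1 < / a) by (rewrite <- Rinv_1; apply Rinv_lt_contravar; lra).
simpl. split; [| split; [| split]]; try easy; apply Hr; lra.
Qed.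

(** On the unit circle the Fuchsian system is the linear system of the torus
    equation: partial fractions in [zeta], with [cos tau = (zeta + 1 / zeta) / 2] and
    [sin tau = (zeta - 1 / zeta) / (2 i)]. *)
Lemma torus_connection s :
  conn torus_poles (eis s) (Ci * eis s) =
  riccati (RtoC (drift omega delta A B D s)) (RtoC (gain omega delta s)).
Proof.
destruct (eis_regular s) as (R0 & R1 & R2 & _).
apply Cminus_neq_0 in R0, R1, R2.
assert (Hd := delta_bounds).
assert (Hden := denominator_neq_0 omega delta Ho Hd s).
assert (Hcos : RtoC (cos s) = ((eis s + / eis s) / 2)%C).
{ generalize (eis_sqr s). unfold eis. generalize (cos s) (sin s). intros c d H.
  apply injective_projections; simpl; replace (c * (c * 1) + d * (d * 1)) with 1 by lra; field. }
assert (Hsin : RtoC (sin s) = (- Ci * (eis s - / eis s) / 2)%C).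
{ generalize (eis_sqr s). unfold eis. generalize (cos s) (sin s). intros c d H.
  apply injective_projections; simpl; replace (c * (c * 1) + d * (d * 1)) with 1 by lra; field. }
assert (Hgain : RtoC (gain omega delta s) =
  (/ (RtoC omega * (1 - RtoC (2 * a) / (1 + RtoC a * RtoC a) * RtoC (cos s))))%C).
{ unfold gain. rewrite RtoC_inv, RtoC_mult, RtoC_minus, RtoC_mult by easy.
  unfold delta. rewrite RtoC_div, RtoC_plus by nra. repeat f_equal.
  rewrite <- RtoC_mult. f_equal. ring. }
assert (Na : RtoC a <> 0) by (apply RtoC_neq_0; lra).
assert (Nw : RtoC omega <> 0) by now apply RtoC_neq_0.
assert (Np : (1 + RtoC a * RtoC a)%C <> 0).
{ rewrite <- RtoC_mult, <- RtoC_plus. apply RtoC_neq_0. nra. }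
assert (Nm : (1 - RtoC a * RtoC a)%C <> 0).
{ rewrite <- RtoC_mult, <- RtoC_minus. apply RtoC_neq_0. nra. }
assert (Hrg : gain_residue = (- Ci * ((1 + RtoC a * RtoC a) / (RtoC omega * (1 - RtoC a * RtoC a))))%C).
{ unfold gain_residue. f_equal. rewrite RtoC_div, RtoC_plus, RtoC_mult, RtoC_minus.
  2: { apply Rmult_integral_contrapositive_currified; [easy | nra]. }
  replace (a ^ 2) with (a * a) by ring. now rewrite !RtoC_mult. }
assert (Hsr : sine_residue = (RtoC A * (1 + RtoC a * RtoC a) / (2 * RtoC omega * RtoC a))%C).
{ unfold sine_residue. rewrite RtoC_div, !RtoC_mult, RtoC_plus.
  2: { repeat apply Rmult_integral_contrapositive_currified; lra. }
  replace (a ^ 2) with (a * a) by ring. now rewrite !RtoC_mult. }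
replace (eis s - 0)%C with (eis s) in R0 by ring. rewrite RtoC_inv in R2 by lra.
assert (R2' : (RtoC a * eis s - 1)%C <> 0).
{ replace (RtoC a * eis s - 1)%C with (RtoC a * (eis s - / RtoC a))%C by (field; easy).
  now apply Cmult_neq_0. }
assert (Hii : (Ci * Ci)%C = (- (1))%C) by (apply injective_projections; simpl; ring).
set (u := (Ci * eis s / (eis s - RtoC a))%C).
set (v := (Ci * eis s / (eis s - / RtoC a))%C).
assert (Hg : (u * gain_residue - v * gain_residue)%C = RtoC (gain omega delta s)).
{ rewrite Hgain, Hrg, Hcos. unfold u, v.
  transitivity (- (Ci * Ci) * ((eis s / (eis s - RtoC a) - eis s / (eis s - / RtoC a)) *
     ((1 + RtoC a * RtoC a) / (RtoC omega * (1 - RtoC a * RtoC a)))))%C.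
  { unfold Cdiv. ring. }
  rewrite Hii, RtoC_mult.
  replace (1 - RtoC 2 * RtoC a / (1 + RtoC a * RtoC a) * ((eis s + / eis s) / 2))%C with
    (- ((eis s - RtoC a) * (RtoC a * eis s - 1)) / ((1 + RtoC a * RtoC a) * eis s))%C
    by (field; auto).
  field. repeat split; auto. }
assert (Hh : (- (Ci * Ci) * RtoC D - Ci * sine_residue +
   (u * (RtoC B * gain_residue + sine_residue) + v * (- (RtoC B * gain_residue) + sine_residue)))%C =
   RtoC (drift omega delta A B D s)).
{ unfold drift. rewrite RtoC_plus, RtoC_mult, RtoC_plus, RtoC_mult, Hsin.
  transitivity (RtoC B * (u * gain_residue - v * gain_residue) + RtoC D +
    sine_residue * (u + v - Ci))%C.
  { rewrite Hii. ring. }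
  rewrite Hg, Hgain, Hcos, Hsr. unfold u, v. rewrite RtoC_mult.
  replace (1 - RtoC 2 * RtoC a / (1 + RtoC a * RtoC a) * ((eis s + / eis s) / 2))%C with
    (- ((eis s - RtoC a) * (RtoC a * eis s - 1)) / ((1 + RtoC a * RtoC a) * eis s))%C
    by (field; auto).
  field. repeat split; auto. }
unfold torus_poles. simpl. rewrite RtoC_inv by lra. fold u v.
replace (Ci * eis s / (eis s - 0))%C with Ci by (replace (eis s - 0)%C with (eis s) by ring; field; easy).
rewrite <- Hg, <- Hh.
generalize u v gain_residue sine_residue (RtoC B) (RtoC D). intros x y r t b d.
unfold riccati. generalize (Ci / 2)%C. intros c. mring; ring.
Qed.

(** The holonomy of the unit circle is [c = 1] or [c = -1], so the traces around the
    two inner poles agree up to the factor [c].  The left-hand side is [4 mu^2], the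
    right-hand side [(2 lam - k)^2], for the exponents [mu] at [a] and [lam] at 0.

    The circle [loop] passes through 1 and [a^2] and surrounds [a] but not 0. *)
Lemma torus_identity_monodromy :
  poincare_is_identity (torus_rhs omega delta A B D) ->
  exists k : Z, (4 * (- ((RtoC B * gain_residue + sine_residue) * (RtoC B * gain_residue + sine_residue)
      - gain_residue * gain_residue) / 4))%C =
    ((Ci * (- (Ci * RtoC D) - sine_residue) - RtoC (IZR k)) *
     (Ci * (- (Ci * RtoC D) - sine_residue) - RtoC (IZR k)))%C.
Proof.
intros Hid. assert (Hpi := PI_RGT_0). assert (HT : 0 <= 2 * PI) by lra.
assert (Hd := delta_bounds).
assert (Hinv : 1 < / a) by (rewrite <- Rinv_1; apply Rinv_lt_contravar; lra).
set (m := (1 + a ^ 2) / 2). set (n := (1 - a ^ 2) / 2).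
assert (Hn : 0 < n) by (unfold n; nra). assert (Hmn : n < m) by (unfold n, m; nra).
assert (Hmp : m + n = 1) by (unfold n, m; field).
assert (Hmm : m - n = a ^ 2) by (unfold n, m; field).
destruct (linear_ode_exists (fun s => riccati (RtoC (drift omega delta A B D s))
  (RtoC (gain omega delta s))) (2 * PI) HT) as [G0 HG0].
{ intros s _. 
  assert (Hr : forall f : R -> R, continuous f s -> continuous (fun s => RtoC (f s)) s).
  { intros f Hf. apply continuous_C; simpl. apply Hf. apply continuous_const. }
  assert (C1 := Hr _ (gain_continuous omega delta Ho Hd s)).
  assert (C2 := Hr _ (drift_continuous omega delta A B D Ho Hd s)).
  apply continuous_mscal. apply continuous_const.
  apply continuous_mat; unfold e11, e12, e21, e22, mat; simpl; auto using continuous_Copp. }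
destruct (riccati_holonomy_scalar (gain omega delta) (drift omega delta A B D) G0)
  as [c [Hc HG0c]].
{ apply gain_continuous; easy. }
{ apply drift_continuous; easy. }
{ exact HG0. }
{ now apply poincare_identity_lift. }
assert (Hreg : forall s t, 0 <= s <= 2 * PI -> 0 <= t <= PI ->
  regular torus_poles (join m n s t)).
{ intros s t Hs Ht.
  assert (Hr : forall r, 0 <= r -> r <> 1 -> r <> a ^ 2 -> join m n s t <> RtoC r).
  { intros r H0 H1 H2 E.
    destruct (join_avoids m n Hn Hmn s t Hs Ht) as [H | H]; rewrite E in *; simpl in *.
    easy. lra. lra. }
  simpl. split; [| split; [| split]]; try easy; apply Hr; nra. }
destruct (linear_ode_exists (fun s => conn torus_poles (join m n s PI) (join_s m n s PI))
  (2 * PI) HT) as [G1 HG1].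
{ apply (conn_slice_continuous _ _ _ _ _ (join_family m n)).
  intros s Hs. apply Hreg; lra. }
assert (Hloop : forall s, loop m n s = circ (RtoC a) ((1 - a) ^ 2 / 2) (a * (1 - a)) s 1).
{ intros s. unfold loop, circ, m, n. apply injective_projections; simpl; field. }
assert (Hloop' : forall s, loop' n s = circ_s (RtoC a) ((1 - a) ^ 2 / 2) (a * (1 - a)) s 1).
{ intros s. unfold loop', circ_s, n. apply injective_projections; simpl; field. }
set (l0 := (RtoC 0, riccati (- (Ci * RtoC D) - sine_residue) 0)) in *.
set (la := (RtoC a, riccati (RtoC B * gain_residue + sine_residue) gain_residue)).
set (lb := (RtoC (/ a), riccati (- (RtoC B * gain_residue) + sine_residue) (- gain_residue))).
assert (Hcirc : forall s t, 0 < t <= 1 ->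
  regular (l0 :: lb :: nil) (circ (RtoC a) ((1 - a) ^ 2 / 2) (a * (1 - a)) s t)).
{ intros s t Ht.
  (* A circle of the family meets the real axis between a^2 and 1 only. *)
  assert (Hr : forall r, circ (RtoC a) ((1 - a) ^ 2 / 2) (a * (1 - a)) s t = RtoC r ->
    a ^ 2 <= r <= 1).
  { intros r Er.
    set (k := (1 - a) ^ 2 / 2) in *. set (u := a * (1 - a)) in *.
    assert (Hk : 0 <= k) by (unfold k; nra). assert (Hu : 0 < u) by (unfold u; nra).
    assert (Hau : a - u = a ^ 2) by (unfold u; ring).
    assert (Hak : a + u + 2 * k = 1) by (unfold u, k; field).
    clearbody k u.
    apply (f_equal fst) in Er as E1. apply (f_equal snd) in Er as E2.
    simpl in E1, E2.
    assert (Hs : sin s = 0).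
    { assert (H1 : sin s * (u * t + k * t ^ 2) = 0) by lra.
      apply Rmult_integral in H1. destruct H1 as [H1 | H1]; [easy |].
      assert (0 < u * t) by nra. assert (0 <= k * t ^ 2) by (apply Rmult_le_pos; nra). lra. }
    rewrite Hs in E1.
    assert (Htt : 0 <= t ^ 2 <= 1) by (split; nra).
    assert (Ht2 : 0 <= k * t ^ 2 <= k) by (split; nra).
    assert (Hut : 0 < u * t <= u) by (split; nra).
    assert (Hr : r = a + k * t ^ 2 + cos s * (u * t + k * t ^ 2)) by lra.
    generalize (COS_bound s). intros Hb.
    assert (Hv : 0 <= u * t + k * t ^ 2) by lra.
    generalize (Rmult_le_compat_r _ _ _ Hv (proj1 Hb)) (Rmult_le_compat_r _ _ _ Hv (proj2 Hb)).
    split; lra. }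
  assert (0 < a ^ 2) by nra.
  split; [| split]; [| | easy]; intros F; apply Hr in F; lra. }
destruct (linear_ode_exists (fun s => conn (la :: l0 :: lb :: nil)
  (circ (RtoC a) ((1 - a) ^ 2 / 2) (a * (1 - a)) s 1)
  (circ_s (RtoC a) ((1 - a) ^ 2 / 2) (a * (1 - a)) s 1)) (2 * PI) HT) as [E HE].
{ apply (conn_slice_continuous _ _ _ _ _ (circ_family (RtoC a) _ _)).
  intros s _. split; [| apply Hcirc; lra].
  apply circ_neq_centre; nra. }
destruct (Csqrt_exists (- ((RtoC B * gain_residue + sine_residue) *
  (RtoC B * gain_residue + sine_residue) - gain_residue * gain_residue) / 4)) as [mu Hmu].
assert (HtrE : mtr (E (2 * PI)) =
  (cexp (Ci * mu * RtoC (2 * PI)) + cexp (- (Ci * mu) * RtoC (2 * PI)))%C).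
{ apply (shrinking_circle_trace (RtoC a) (snd la) (l0 :: lb :: nil)
    ((1 - a) ^ 2 / 2) (a * (1 - a))); try easy.
  - nra.
  - nra.
  - apply riccati_traceless.
  - simpl. now rewrite riccati_square, Hmu.
  - simpl. split; [| split]; try easy; intros F; apply RtoC_inj in F; lra. }
set (lam := (Ci * (- (Ci * RtoC D) - sine_residue) / 2)%C).
assert (HtrG : mtr (G1 (2 * PI)) =
  (cexp (Ci * lam * RtoC (2 * PI)) + cexp (- (Ci * lam) * RtoC (2 * PI)))%C).
{ apply (shrinking_circle_trace (RtoC 0) (snd l0) (la :: lb :: nil) 0 (a ^ 2)).
  - nra.
  - lra.
  - apply riccati_traceless.
  - simpl. rewrite riccati_square. f_equal. unfold lam.
    transitivity (- (- (Ci * D) - sine_residue) * (- (Ci * D) - sine_residue) / 4)%C.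
    unfold Cdiv. ring.
    transitivity (Ci * Ci * (- (Ci * D) - sine_residue) * (- (Ci * D) - sine_residue) / 4)%C.
    replace (Ci * Ci)%C with (- (1))%C by (apply injective_projections; simpl; ring).
    unfold Cdiv. ring. field.
  - simpl. split; [| split]; try easy; intros F; apply RtoC_inj in F; lra.
  - intros s t Ht.
    assert (Hr : forall r, a <= r -> circ (RtoC 0) 0 (a ^ 2) s t <> RtoC r).
    { intros r Hr Er. apply (f_equal fst) in Er as E1. simpl in E1. generalize (eis_sqr s). intros Hs.
      assert (H1 : cos s * (a ^ 2 * t) = r) by lra.
      assert (H2 : a ^ 2 * t <= a ^ 2) by nra. assert (H3 : 0 < a ^ 2 * t) by nra.
      generalize (COS_bound s). nra. }
    simpl. split; [| split]; try easy; apply Hr; lra.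
  - apply (solves_ext (fun s => conn torus_poles (join m n s PI) (join_s m n s PI))); [| easy].
    intros s. unfold torus_poles. fold l0 la lb. f_equal.
    + unfold join, circ. rewrite cos_PI, sin_PI, <- Hmm.
      apply injective_projections; simpl; ring.
    + unfold join_s, circ_s. rewrite cos_PI, sin_PI, <- Hmm.
      apply injective_projections; simpl; ring. }
assert (Htrace : mtr (G1 (2 * PI)) = (c * mtr (E (2 * PI)%R))%C).
{ apply (join_trace m n torus_poles c G0 G1 E Hreg).
  - simpl. split; [| split; [| split]]; try apply riccati_traceless. exact I.
  - apply (solves_ext (fun s => riccati (RtoC (drift omega delta A B D s))
      (RtoC (gain omega delta s)))); [| easy].
    intros s. rewrite <- torus_connection. f_equal.
    + unfold join. rewrite cos_0, sin_0, Rmult_1_r, Hmp.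
      apply injective_projections; simpl; ring.
    + unfold join_s. rewrite cos_0, sin_0, Rmult_1_r, Hmp.
      apply injective_projections; simpl; ring.
  - exact HG1.
  - apply (solves_ext (fun s => conn (la :: l0 :: lb :: nil)
      (circ (RtoC a) ((1 - a) ^ 2 / 2) (a * (1 - a)) s 1)
      (circ_s (RtoC a) ((1 - a) ^ 2 / 2) (a * (1 - a)) s 1))); [| easy].
    intros s. now rewrite Hloop, Hloop', conn_swap.
  - exact HG0c. }
rewrite HtrE, HtrG in Htrace.
destruct (cosine_equation lam mu c Hc Htrace) as [k Hk].
exists k. rewrite <- Hmu, Hk. unfold lam. f_equal; field.
Qed.
End Monodromy.

(** Put [a = (1 - q) / delta] with [q = sqrt (1 - delta^2)].  In the relation between
    the exponents, the terms in [A^2] on the two sides cancel, so its real part is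
    the stated equation.  Its imaginary part is [A * (B x + D - n) = 0] up to a
    nonzero factor, with [x = 1 / (omega q)]; if [B x + D - n] vanished, the real part
    [(B^2 - 1) x^2 = (D - n)^2] would become [B^2 - 1 = B^2]. *)
Lemma torus_identity_parameters (omega delta A B D : R) :
  omega <> 0 -> 0 < delta < 1 ->
  poincare_is_identity (torus_rhs omega delta A B D) ->
  A = 0 /\ exists n : Z, B ^ 2 - 1 = omega ^ 2 * (1 - delta ^ 2) * (D - IZR n) ^ 2.
Proof.
intros Ho Hd Hid.
set (q := sqrt (1 - delta ^ 2)).
assert (Hq : q * q = 1 - delta ^ 2) by (apply sqrt_sqrt; nra).
assert (Hq0 : 0 < q) by (apply sqrt_lt_R0; nra).
set (a := (1 - q) / delta).
assert (Had : a * delta = 1 - q) by (unfold a; field; lra).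
assert (Hq1 : q < 1) by nra.
assert (Ha : 0 < a < 1).
{ split. apply Rdiv_lt_0_compat; lra.
  apply Rmult_lt_reg_r with delta; [lra |]. rewrite Had. nra. }
assert (Hda : delta * (1 + a ^ 2) = 2 * a).
{ apply Rmult_eq_reg_r with delta; [| lra].
  transitivity (delta ^ 2 + (a * delta) ^ 2); [ring |].
  transitivity (2 * (a * delta)); [| ring]. rewrite Had. nra. }
assert (Hqa : q * (1 + a ^ 2) = 1 - a ^ 2).
{ apply Rmult_eq_reg_r with (delta ^ 2); [| nra].
  transitivity (q * (delta ^ 2 + (a * delta) ^ 2)); [ring |].
  transitivity (delta ^ 2 - (a * delta) ^ 2); [| ring]. rewrite Had.
  replace (delta ^ 2) with (1 - q * q) by lra. ring. }
assert (Hp : 0 < 1 + a ^ 2) by nra.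
replace delta with (2 * a / (1 + a ^ 2)) in Hid.
2: { rewrite <- Hda. field. lra. }
destruct (torus_identity_monodromy omega a A B D Ho Ha Hid) as [k Hk].
unfold gain_residue, sine_residue in Hk.
set (x := (1 + a ^ 2) / (omega * (1 - a ^ 2))) in *.
set (y := A * (1 + a ^ 2) / (2 * omega * a)) in *.
assert (Hx : x * (omega * q) = 1).
{ unfold x. rewrite <- Hqa. field. repeat split; lra. }
assert (H1 : (B ^ 2 - 1) * x ^ 2 = (D - IZR k) ^ 2 /\ y * (B * x + (D - IZR k)) = 0).
{ apply (f_equal fst) in Hk as K1. apply (f_equal snd) in Hk as K2. simpl in K1, K2.
  split; lra. }
destruct H1 as [H1 H2].
assert (Hx0 : x <> 0) by (intros F; rewrite F in Hx; lra).
split.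
- apply Rmult_integral in H2. destruct H2 as [H2 | H2].
  + assert (HA : A = y * (2 * omega * a / (1 + a ^ 2))).
    { unfold y. field. repeat split; lra. }
    rewrite HA, H2. ring.
  + exfalso. assert (x ^ 2 <> 0) by now apply pow_nonzero.
    assert (x ^ 2 = 0) by nra. easy.
- exists k. rewrite <- H1, <- Hq.
  transitivity ((B ^ 2 - 1) * (x * (omega * q)) ^ 2); [rewrite Hx; ring | ring].
Qed.

Theorem theorem24 :
  (forall omega delta A B D : R,
      omega <> 0 -> 0 < delta < 1 -> A <> 0 ->
      ~ poincare_is_identity (torus_rhs omega delta A B D)) /\
  (forall omega delta B D : R,
      omega <> 0 -> 0 < delta < 1 ->
      poincare_is_identity (torus_rhs omega delta 0 B D) ->
      exists n : Z,
        B ^ 2 - 1 = omega ^ 2 * (1 - delta ^ 2) * (D - IZR n) ^ 2).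
Proof.
split.
- intros omega delta A B D Ho Hd HA Hid. apply HA.
  now apply (torus_identity_parameters omega delta A B D).
- intros omega delta B D Ho Hd Hid.
  now apply (torus_identity_parameters omega delta 0 B D).
Qed.
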